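(* Let $k$ be a Noetherian commutative ring and let $A$ be an associative unital $k$-algebra equipped with an augmentation whose augmentation ideal is free as a $k$-module (with countable basis). If $A$ is finitely-generated over $k$ (as a $k$-module), then $HS_*(A)$ is finitely-generated over $k$ in each degree.
   Context: Put $[n]=\{0,1,\dots,n\}$. The category $\Delta S$ has objects $[n]$, $n\ge 0$; a morphism $\alpha:[n]\to[m]$ is a set map together with a total ordering on each fiber. Composition composes the set maps, and the fibers of $\beta\alpha$ are ordered lexicographically (first by the order of $\alpha(i)$ in the fiber of $\beta$, then by the order in the fiber of $\alpha$). $B_*^{sym}A:\Delta S\to k\text{-}\mathbf{Mod}$ is the functor $[n]\mapsto A^{\otimes(n+1)}$ with $\alpha:[n]\to[m]$ sending $a_0\otimes\dots\otimes a_n$ to $b_0\otimes\dots\otimes b_m$, where $b_j$ is the product of the $a_i$, $i\in\alpha^{-1}(j)$, in the given order ($b_j=1_A$ if the fiber is empty). For a contravariant functor $M$ and a covariant functor $N$ from $\Delta S$ to $k$-modules, $M\otimes_{\Delta S}N=\bigoplus_X M(X)\otimes_k N(X)$ modulo $y\otimes f_*(x)\approx f^*(y)\otimes x$, and $\mathrm{Tor}^{\Delta S}_*$ denotes its derived functors. The symmetric homology of $A$ is $HS_*(A)=\mathrm{Tor}_*^{\Delta S}(\underline{k},B_*^{sym}A)$, with $\underline{k}$ the constant contravariant functor with value $k$. *)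

(* Defs.v *)
From HB Require Import structures.
From mathcomp Require Import all_boot all_algebra.
From mathcomp Require Import boolp.
From mathcomp Require Import freeg.

Set Implicit Arguments.
Unset Strict Implicit.
Unset Printing Implicit Defensive.

Import GRing.Theory.
Local Open Scope ring_scope.

Section Noetherian.
Variable k : comNzRingType.

Definition is_ideal (I : k -> Prop) : Prop :=
  [/\ I 0, forall x y, I x -> I y -> I (x + y) & forall c x, I x -> I (c * x)].

Definition noetherian : Prop :=
  forall I : k -> Prop, is_ideal I ->
    exists s : seq k, forall x : k,
      I x <-> exists c : 'I_(size s) -> k, x = \sum_(i < size s) c i * s`_i.

Definition fin_gen (V : lmodType k) : Prop :=
  exists s : seq V, forall x : V,
    exists c : 'I_(size s) -> k, x = \sum_(i < size s) c i *: s`_i.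

Definition is_basis (V : lmodType k) (J : eqType) (b : J -> V) : Prop :=
  (forall x : V, exists (s : seq J) (c : J -> k), x = \sum_(j <- s) c j *: b j)
  /\ (forall (s : seq J) (c : J -> k), uniq s ->
        \sum_(j <- s) c j *: b j = 0 -> forall j, j \in s -> c j = 0).

(* A countType is finite or countably infinite. *)
Definition free_countable (V : lmodType k) : Prop :=
  exists (J : countType) (b : J -> V), is_basis b.

End Noetherian.

Section Kernel.
Variables (k : comNzRingType) (V W : lmodType k) (f : {linear V -> W}).

Definition kerpred : {pred V} := [pred x | f x == 0].

Fact kerpred_submod : submod_closed kerpred.
Proof.
split=> [|c x y]; rewrite !inE ?linear0 // => /eqP fx /eqP fy.
by rewrite linearP fx fy scaler0 addr0.
Qed.
HB.instance Definition _ := GRing.isSubmodClosed.Build k V kerpred kerpred_submod.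

Definition kermod := {x : V | kerpred x}.
HB.instance Definition _ := SubChoice.on kermod.
HB.instance Definition _ := [SubChoice_isSubLmodule of kermod by <:].

Lemma kermodP (x : kermod) : f (val x) = 0.
Proof. by case: x => x /= /eqP. Qed.

End Kernel.

Section QuotientModule.
Variables (k : comNzRingType) (V : lmodType k) (S : V -> Prop).

Definition span : {pred V} := [pred v | `[<
  exists s : seq (k * V), (forall p, p \in s -> S p.2)
    /\ v = \sum_(p <- s) p.1 *: p.2 >] ].

Fact span_submod : submod_closed span.
Proof.
split=> [|c x y].
  by apply/asboolP; exists [::]; split => //; rewrite big_nil.
move=> /asboolP[s [sS ->]] /asboolP[t [tS ->]]; apply/asboolP.
exists ([seq (c * p.1, p.2) | p <- s] ++ t); split.
  by move=> p; rewrite mem_cat => /orP[/mapP[q /sS Sq ->]|/tS].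
rewrite big_cat big_map /= scaler_sumr; congr (_ + _).
by apply: eq_bigr => p _; rewrite scalerA.
Qed.
HB.instance Definition _ := GRing.isSubmodClosed.Build k V span span_submod.

Lemma mem_span v : S v -> v \in span.
Proof.
move=> Sv; apply/asboolP; exists [:: (1, v)]; split.
  by move=> p; rewrite inE => /eqP ->.
by rewrite big_seq1 scale1r.
Qed.

(* The quotient of V by the submodule generated by S. *)
Definition qmod := Quotient.quot span.
HB.instance Definition _ := Choice.on qmod.
HB.instance Definition _ := GRing.Zmodule.on qmod.

Definition qproj0 (v : V) : qmod := (\pi_(Quotient.quot span) v)%qT.

Lemma qproj0_eq x y : qproj0 x = qproj0 y <-> x - y \in span.
Proof. by rewrite Quotient.idealrBE; split => [e|/eqP //]; apply/eqP. Qed.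

Lemma qproj0D x y : qproj0 (x + y) = qproj0 x + qproj0 y.
Proof. exact: (raddfD (\pi_(Quotient.quot span))%qT). Qed.

Definition qrepr (q : qmod) : V := repr (q : Quotient.quot span).

Lemma qreprK q : qproj0 (qrepr q) = q.
Proof. exact: reprK. Qed.

Definition qscale (c : k) (q : qmod) : qmod := qproj0 (c *: qrepr q).

Lemma qscaleE c v : qscale c (qproj0 v) = qproj0 (c *: v).
Proof.
apply/qproj0_eq; rewrite -scalerBr rpredZ //.
by apply/qproj0_eq; rewrite qreprK.
Qed.

Fact qscaleA a b q : qscale a (qscale b q) = qscale (a * b) q.
Proof. by rewrite -[q]qreprK !qscaleE scalerA. Qed.
Fact qscale1 : left_id 1 qscale.
Proof. by move=> q; rewrite -[q]qreprK qscaleE scale1r. Qed.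
Fact qscaleDr : right_distributive qscale +%R.
Proof.
by move=> c p q; rewrite -[p]qreprK -[q]qreprK -qproj0D !qscaleE scalerDr qproj0D.
Qed.
Fact qscaleDl q : {morph qscale^~ q : a b / a + b}.
Proof. by move=> a b; rewrite -[q]qreprK !qscaleE scalerDl qproj0D. Qed.
HB.instance Definition _ :=
  GRing.Zmodule_isLmodule.Build k qmod qscaleA qscale1 qscaleDr qscaleDl.

Fact qproj0_linear : linear qproj0.
Proof. by move=> c x y; rewrite qproj0D -qscaleE. Qed.
HB.instance Definition _ := GRing.isLinear.Build k V qmod *:%R qproj0 qproj0_linear.
Definition qproj : {linear V -> qmod} := qproj0.

Lemma qmod_ind (T : qmod -> Prop) : (forall v, T (qproj v)) -> forall q, T q.
Proof. by move=> H q; rewrite -[q]qreprK; exact: H. Qed.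

Lemma qproj_eq0 v : S v -> qproj v = 0.
Proof.
by move=> Sv; rewrite -(linear0 qproj); apply/qproj0_eq; rewrite subr0 mem_span.
Qed.

Section Lift.
Variables (W : lmodType k) (f : {linear V -> W}) (fS : forall v, S v -> f v = 0).

Lemma span_ker v : v \in span -> f v = 0.
Proof.
case/asboolP=> s [sS ->]; rewrite linear_sum big_seq big1 // => p ps.
by rewrite linearZ /= fS ?scaler0 //; exact: sS.
Qed.

Definition qlift0 (q : qmod) : W := f (qrepr q).

Lemma qlift0E v : qlift0 (qproj v) = f v.
Proof.
apply/eqP; rewrite -subr_eq0 -linearB /= span_ker //.
by apply/qproj0_eq; rewrite qreprK.
Qed.

Fact qlift0_linear : linear qlift0.
Proof.
move=> c; elim/qmod_ind => x; elim/qmod_ind => y.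
by rewrite -linearP !qlift0E linearP.
Qed.
HB.instance Definition _ := GRing.isLinear.Build k qmod W *:%R qlift0 qlift0_linear.
Definition qlift : {linear qmod -> W} := qlift0.

Lemma qliftE v : qlift (qproj v) = f v. Proof. exact: qlift0E. Qed.

End Lift.
End QuotientModule.

Section DirectSum.
Variables (k : comNzRingType) (I : eqType) (F : I -> lmodType k).

Definition dprod := forall i, F i.
HB.instance Definition _ := gen_eqMixin dprod.
HB.instance Definition _ := gen_choiceMixin dprod.

Implicit Types f g : dprod.
Definition dadd f g : dprod := fun i => f i + g i.
Definition dopp f : dprod := fun i => - f i.
Definition dscale (c : k) f : dprod := fun i => c *: f i.
Fact daddA : associative dadd.
Proof. by move=> f g h; apply: functional_extensionality_dep => i; exact: addrA. Qed.
Fact daddC : commutative dadd.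
Proof. by move=> f g; apply: functional_extensionality_dep => i; exact: addrC. Qed.
Fact dadd0 : left_id (fun i => 0 : F i) dadd.
Proof. by move=> f; apply: functional_extensionality_dep => i; exact: add0r. Qed.
Fact daddN : left_inverse (fun i => 0 : F i) dopp dadd.
Proof. by move=> f; apply: functional_extensionality_dep => i; exact: addNr. Qed.
HB.instance Definition _ := GRing.isZmodule.Build dprod daddA daddC dadd0 daddN.
Fact dscaleA a b f : dscale a (dscale b f) = dscale (a * b) f.
Proof. by apply: functional_extensionality_dep => i; exact: scalerA. Qed.
Fact dscale1 : left_id 1 dscale.
Proof. by move=> f; apply: functional_extensionality_dep => i; exact: scale1r. Qed.
Fact dscaleDr : right_distributive dscale +%R.
Proof. by move=> c f g; apply: functional_extensionality_dep => i; exact: scalerDr. Qed.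
Fact dscaleDl f : {morph dscale^~ f : a b / a + b}.
Proof. by move=> a b; apply: functional_extensionality_dep => i; exact: scalerDl. Qed.
HB.instance Definition _ :=
  GRing.Zmodule_isLmodule.Build k dprod dscaleA dscale1 dscaleDr dscaleDl.

Definition finsupp : {pred dprod} := [pred f : dprod | `[<
  exists s : seq I, forall i, i \notin s -> f i = 0 >] ].
Fact finsupp_submod : submod_closed finsupp.
Proof.
split=> [|c f g]; first by apply/asboolP; exists [::].
move=> /asboolP[s fs] /asboolP[t gt]; apply/asboolP; exists (s ++ t) => i.
rewrite mem_cat negb_or => /andP[/fs fi /gt gi].
by change (c *: f i + g i = 0); rewrite fi gi scaler0 addr0.
Qed.
HB.instance Definition _ := GRing.isSubmodClosed.Build k dprod finsupp finsupp_submod.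

Definition dsum := {f : dprod | finsupp f}.
HB.instance Definition _ := SubChoice.on dsum.
HB.instance Definition _ := [SubChoice_isSubLmodule of dsum by <:].

(* The i-th inclusion; the transport is along an equality in I, which is
   proof-irrelevant. *)
Definition din_fun i (x : F i) : dprod := fun j =>
  if i =P j is ReflectT e then ecast j (F j) e x else 0.
Fact din_fin i (x : F i) : finsupp (din_fun x).
Proof.
apply/asboolP; exists [:: i] => j; rewrite inE /din_fun.
by move=> nji; case: eqP => // e; rewrite e eqxx in nji.
Qed.
Definition din i (x : F i) : dsum := exist _ (din_fun x) (din_fin x).

End DirectSum.

Section DirectSumMap.
Variables (k : comNzRingType) (I : eqType) (F G : I -> lmodType k).
Variable f : forall i, {linear F i -> G i}.

Definition dmap_fun (u : dsum F) : dprod G := fun i => f i (val u i).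
Fact dmap_fin (u : dsum F) : finsupp (dmap_fun u).
Proof.
have /asboolP[s us] := valP u; apply/asboolP; exists s => i /us ui.
by rewrite /dmap_fun ui linear0.
Qed.
Definition dmap0 (u : dsum F) : dsum G := exist _ (dmap_fun u) (dmap_fin u).
Fact dmap0_linear : linear dmap0.
Proof.
move=> c u v; apply: val_inj; apply: functional_extensionality_dep => i.
exact: linearP.
Qed.
HB.instance Definition _ :=
  GRing.isLinear.Build k (dsum F) (dsum G) *:%R dmap0 dmap0_linear.
Definition dmap : {linear dsum F -> dsum G} := dmap0.

Lemma dmap_in i (x : F i) : dmap (din x) = din (f i x).
Proof.
apply: val_inj; apply: functional_extensionality_dep => j.
change (f j (din_fun x j) = din_fun (f i x) j).
by rewrite /din_fun; case: eqP => [e|_]; [case: _ / e | rewrite linear0].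
Qed.

Lemma din_is_linear i c (x y : F i) : din (c *: x + y) = c *: din x + din y.
Proof.
apply: val_inj; apply: functional_extensionality_dep => j.
change (din_fun (c *: x + y) j = c *: din_fun x j + din_fun y j).
by rewrite /din_fun; case: eqP => [e|_]; [case: _ / e | rewrite scaler0 addr0].
Qed.

End DirectSumMap.

Section FreeModule.
Variables (k : comNzRingType) (X : choiceType).

Definition gen (x : X) : {freeg X / k} := << x >>.

Lemma freegE (D : {freeg X / k}) : D = \sum_(x <- dom D) coeff x D *: gen x.
Proof.
rewrite -{1}[D]freeg_sumE; apply: eq_bigr => x _; apply/eqP/freeg_eqP => y.
by rewrite coeffZ !coeffU mul1r.
Qed.

Section FreeLift.
Variables (W : lmodType k) (g : X -> W).

Fact fglift_linear : linear (fglift g : {freeg X / k} -> W).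
Proof.
have fgD := lift_is_additive g.
have fg0 : fglift g 0 = 0 by rewrite -[X in fglift g X](subrr 0) fgD subrr.
have fgA : {morph fglift g : x y / x + y}.
  by move=> x y; rewrite -[y in LHS]opprK fgD -[- y]sub0r fgD fg0 sub0r opprK.
have fgS (I : Type) (r : seq I) (F : I -> {freeg X / k}) :
    fglift g (\sum_(i <- r) F i) = \sum_(i <- r) fglift g (F i).
  by elim/big_rec2: _ => [|i y1 y2 _ <-] //; rewrite fgA.
have fgU a x : fglift g (a *: gen x) = a *: g x.
  rewrite (_ : a *: gen x = << a *g x >>) ?liftU //.
  by apply/eqP/freeg_eqP => y; rewrite coeffZ !coeffU mul1r.
move=> c u v; rewrite fgA; congr (_ + _).
rewrite [in LHS](freegE u) [in RHS](freegE u) scaler_sumr !fgS scaler_sumr.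
by apply: eq_bigr => x _; rewrite scalerA !fgU scalerA.
Qed.
HB.instance Definition _ :=
  GRing.isLinear.Build k {freeg X / k} W *:%R (fglift g) fglift_linear.

Definition flift : {linear {freeg X / k} -> W} := fglift g.

Lemma fliftE x : flift (gen x) = g x.
Proof. by rewrite /flift /= liftU scale1r. Qed.

End FreeLift.

Lemma free_ext (W : lmodType k) (f g : {linear {freeg X / k} -> W}) :
  (forall x, f (gen x) = g (gen x)) -> f =1 g.
Proof.
move=> fg u; rewrite (freegE u) !linear_sum; apply: eq_bigr => x _.
by rewrite !linearZ /= fg.
Qed.

End FreeModule.

Section TensorProduct.
Variable k : comNzRingType.

Inductive tens_rel (V W : lmodType k) : {freeg (V * W) / k} -> Prop :=
| TensRelL c (x y : V) (w : W) :
    tens_rel (gen k (c *: x + y, w) - (c *: gen k (x, w) + gen k (y, w)))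
| TensRelR c (v : V) (x y : W) :
    tens_rel (gen k (v, c *: x + y) - (c *: gen k (v, x) + gen k (v, y))).

Definition tens (V W : lmodType k) : lmodType k := qmod (@tens_rel V W).
Definition pure (V W : lmodType k) (v : V) (w : W) : tens V W :=
  qproj (@tens_rel V W) (gen k (v, w)).

Lemma pure_linl (V W : lmodType k) c (x y : V) (w : W) :
  pure (c *: x + y) w = c *: pure x w + pure y w.
Proof.
by apply/eqP; rewrite /pure -linearP -subr_eq0 -linearB qproj_eq0 //; constructor.
Qed.
Lemma pure_linr (V W : lmodType k) c (v : V) (x y : W) :
  pure v (c *: x + y) = c *: pure v x + pure v y.
Proof.
by apply/eqP; rewrite /pure -linearP -subr_eq0 -linearB qproj_eq0 //; constructor.
Qed.

Section Map.
Variables (V V' W : lmodType k) (f : {linear V -> V'}).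

Definition tens_map0 : {linear {freeg (V * W) / k} -> tens V' W} :=
  flift (fun p : V * W => pure (f p.1) p.2).

Fact tens_map_rel u : tens_rel u -> tens_map0 u = 0.
Proof.
case=> [c x y w|c v x y]; rewrite linearB linearP !fliftE /=.
  by rewrite linearP pure_linl subrr.
by rewrite pure_linr subrr.
Qed.

Definition tens_map : {linear tens V W -> tens V' W} := qlift tens_map_rel.

Lemma tens_mapE v w : tens_map (pure v w) = pure (f v) w.
Proof. by rewrite /tens_map /pure qliftE fliftE. Qed.

End Map.
End TensorProduct.

(* A morphism [n] -> [m] of Delta S: the set map, and for each j in [m] the
   fiber over j listed in increasing order. *)
Definition hom_ok n m
    (p : {ffun 'I_n.+1 -> 'I_m.+1} * {ffun 'I_m.+1 -> seq 'I_n.+1}) : bool :=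
  [forall j, uniq (p.2 j) && [forall i, (i \in p.2 j) == (p.1 i == j)]].

Record hom n m := Hom {
  hval : {ffun 'I_n.+1 -> 'I_m.+1} * {ffun 'I_m.+1 -> seq 'I_n.+1};
  homP : hom_ok hval }.
HB.instance Definition _ n m := [isSub for @hval n m].
HB.instance Definition _ n m := [Choice of hom n m by <:].

Definition hmap n m (a : hom n m) := (hval a).1.
Definition hord n m (a : hom n m) := (hval a).2.

Lemma hord_uniq n m (a : hom n m) j : uniq (hord a j).
Proof. by have /forallP/(_ j)/andP[] := homP a. Qed.
Lemma mem_hord n m (a : hom n m) j i : (i \in hord a j) = (hmap a i == j).
Proof. by have /forallP/(_ j)/andP[_ /forallP/(_ i)/eqP] := homP a. Qed.

Lemma hom_ext n m (a b : hom n m) : hmap a = hmap b -> hord a = hord b -> a = b.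
Proof.
move=> e1 e2; apply: val_inj.
by rewrite [LHS]surjective_pairing [RHS]surjective_pairing; congr (_, _).
Qed.

Fact hid_ok n : @hom_ok n n ([ffun i => i], [ffun j => [:: j]]).
Proof.
by apply/forallP => j; rewrite ffunE /=; apply/forallP => i; rewrite inE ffunE.
Qed.
Definition hid n : hom n n := Hom (hid_ok n).

Definition hcomp_val n m p (b : hom m p) (a : hom n m) :=
  ([ffun i => hmap b (hmap a i)],
   [ffun l => flatten [seq hord a j | j <- hord b l]]).

Fact hcomp_ok n m p (b : hom m p) (a : hom n m) : hom_ok (hcomp_val b a).
Proof.
apply/forallP => l; rewrite !ffunE; apply/andP; split.
  elim: (hord b l) (hord_uniq b l) => //= j s IHs /andP[js us].
  rewrite cat_uniq hord_uniq IHs // andbT /=; apply/hasPn => i.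
  case/flatten_mapP => j' j's; rewrite mem_hord => /eqP ij'; rewrite /= mem_hord.
  by apply: contra js => /eqP <-; rewrite ij'.
apply/forallP => i; rewrite ffunE; apply/eqP.
apply/flatten_mapP/eqP.
  by case=> j; rewrite !mem_hord => /eqP <- /eqP ->.
by move=> il; exists (hmap a i); rewrite !mem_hord ?il.
Qed.
Definition hcomp n m p (b : hom m p) (a : hom n m) : hom n p :=
  Hom (hcomp_ok b a).

Lemma hcompA n m p q (c : hom p q) (b : hom m p) (a : hom n m) :
  hcomp c (hcomp b a) = hcomp (hcomp c b) a.
Proof.
apply: hom_ext; apply/ffunP => x; rewrite !ffunE //.
elim: (hord c x) => //= y s IHs.
by rewrite IHs ffunE map_cat flatten_cat.
Qed.
Lemma hcomp1 n m (a : hom n m) : hcomp a (hid n) = a.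
Proof.
apply: hom_ext; apply/ffunP => x; rewrite !ffunE //.
by elim: (hord a x) => //= y s ->; rewrite ffunE.
Qed.
Lemma hcomp1l n m (a : hom n m) : hcomp (hid m) a = a.
Proof.
by apply: hom_ext; apply/ffunP => x; rewrite !ffunE //= cats0.
Qed.

Section Functors.
Variable k : comNzRingType.

Record covfun := CovFun {
  cobj :> nat -> lmodType k;
  cmap : forall n m, hom n m -> {linear cobj n -> cobj m};
  cmap_id : forall n x, cmap (hid n) x = x;
  cmap_comp : forall n m p (b : hom m p) (a : hom n m) x,
    cmap (hcomp b a) x = cmap b (cmap a x) }.

Record confun := ConFun {
  fobj :> nat -> lmodType k;
  fmap : forall n m, hom n m -> {linear fobj m -> fobj n};
  fmap_id : forall n x, fmap (hid n) x = x;
  fmap_comp : forall n m p (b : hom m p) (a : hom n m) x,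
    fmap (hcomp b a) x = fmap a (fmap b x) }.

Record nattrans (M N : confun) := NatTrans {
  ncomp :> forall n, {linear M n -> N n};
  ncompP : forall n m (a : hom n m) (x : M m),
    ncomp n (fmap M a x) = fmap N a (ncomp m x) }.

Definition cst_fun : confun :=
  @ConFun (fun _ => k^o) (fun _ _ _ => idfun : {linear k^o -> k^o})
    (fun _ _ => erefl) (fun _ _ _ _ _ _ => erefl).

Definition pointwise_surj (M N : confun) (e : nattrans M N) : Prop :=
  forall n (y : N n), exists x : M n, e n x = y.

(* Epimorphisms of functors to k-modules are the objectwise surjections. *)
Definition projective (P : confun) : Prop :=
  forall (M N : confun) (e : nattrans M N) (g : nattrans P N),
    pointwise_surj e ->
    exists h : nattrans P M, forall n (x : P n), e n (h n x) = g n x.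

Record proj_resolution (M : confun) := ProjResolution {
  res_obj :> nat -> confun;
  res_d : forall i, nattrans (res_obj i.+1) (res_obj i);
  res_aug : nattrans (res_obj 0%N) M;
  res_proj : forall i, projective (res_obj i);
  res_aug_surj : pointwise_surj res_aug;
  res_exact0 : forall n (x : res_obj 0%N n),
    res_aug n x = 0 <-> exists y, x = res_d 0 n y;
  res_exact : forall i n (x : res_obj i.+1 n),
    res_d i n x = 0 <-> exists y, x = res_d i.+1 n y }.

End Functors.

(* Every functor has a projective resolution, so that quantifying over
   projective resolutions is not vacuous. *)
Section Existence.
Variable k : comNzRingType.
Implicit Type M : confun k.

Definition cover_gen M n : choiceType := {m : nat & (hom n m * M m)%type}.
Definition cgen M n m (a : hom n m) (y : M m) : cover_gen M n :=
  existT (fun m => (hom n m * M m)%type) m (a, y).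

Definition cover_map M n m (f : hom n m) :
    {linear {freeg (cover_gen M m) / k} -> {freeg (cover_gen M n) / k}} :=
  flift (fun g : cover_gen M m =>
    gen k (cgen (hcomp (tagged g).1 f) (tagged g).2)).

Lemma cover_mapE M n m (f : hom n m) p (a : hom m p) (y : M p) :
  cover_map M f (gen k (cgen a y)) = gen k (cgen (hcomp a f) y).
Proof. exact: fliftE. Qed.

Fact cover_map_id M n x : @cover_map M n n (hid n) x = x.
Proof.
apply: (@free_ext _ _ _ (@cover_map M n n (hid n)) idfun) => -[p [a y]].
by rewrite (cover_mapE _ a) hcomp1.
Qed.
Fact cover_map_comp M n m p (b : hom m p) (a : hom n m) x :
  @cover_map M n p (hcomp b a) x = cover_map M a (cover_map M b x).
Proof.
apply: (@free_ext _ _ _ (@cover_map M n p (hcomp b a))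
  (cover_map M a \o cover_map M b)) => -[q [c y]].
change (cover_map M (hcomp b a) (gen k (cgen c y))
  = cover_map M a (cover_map M b (gen k (cgen c y)))).
by rewrite !cover_mapE hcompA.
Qed.
Definition cover M : confun k :=
  @ConFun k (fun n => {freeg (cover_gen M n) / k}) (@cover_map M)
    (@cover_map_id M) (@cover_map_comp M).

Definition cover_lift M (N : confun k) (h : forall m, M m -> N m) n :
    {linear cover M n -> N n} :=
  flift (fun g : cover_gen M n => fmap N (tagged g).1 (h _ (tagged g).2)).

Lemma cover_liftE M N h n m (a : hom n m) (y : M m) :
  @cover_lift M N h n (gen k (cgen a y)) = fmap N a (h m y).
Proof. exact: fliftE. Qed.

Lemma cover_lift_nat M N h n m (f : hom n m) (x : cover M m) :
  @cover_lift M N h n (fmap (cover M) f x) = fmap N f (@cover_lift M N h m x).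
Proof.
apply: (@free_ext _ _ _ (@cover_lift M N h n \o fmap (cover M) f)
  (fmap N f \o @cover_lift M N h m)) => -[q [c y]].
change (@cover_lift M N h n (cover_map M f (gen k (cgen c y)))
  = fmap N f (@cover_lift M N h m (gen k (cgen c y)))).
by rewrite cover_mapE !cover_liftE fmap_comp.
Qed.
Definition cover_ext M N h : nattrans (cover M) N :=
  NatTrans (@cover_lift_nat M N h).

Definition cover_aug M : nattrans (cover M) M := cover_ext (fun m => id).

Lemma cover_aug_surj M : pointwise_surj (cover_aug M).
Proof.
move=> n y; exists (gen k (cgen (hid n) y)).
by rewrite (cover_liftE _ (hid n)) fmap_id.
Qed.

Lemma cover_projective M : projective (cover M).
Proof.
move=> X Y e g esurj.
have [h hP] : {h : forall m, M m -> X m &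
    forall m y, e m (h m y) = g m (gen k (cgen (hid m) y))}.
  exists (fun m y => sval (cid (esurj m (g m (gen k (cgen (hid m) y)))))).
  by move=> m y; case: cid.
exists (cover_ext h) => n x.
apply: (@free_ext _ _ _ (e n \o cover_ext h n) (g n)) => -[q [c y]].
change (e n (cover_lift h n (gen k (cgen c y))) = g n (gen k (cgen c y))).
rewrite cover_liftE ncompP hP -ncompP /=.
by rewrite cover_mapE hcomp1l.
Qed.

Section KernelFunctor.
Variables (M N : confun k) (e : nattrans M N).

Fact ker_map_in n m (f : hom n m) (x : kermod (e m)) :
  kerpred (e n) (fmap M f (val x)).
Proof. by apply/eqP; rewrite ncompP kermodP linear0. Qed.
Definition ker_map0 n m (f : hom n m) (x : kermod (e m)) : kermod (e n) :=
  exist _ (fmap M f (val x)) (ker_map_in f x).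
Fact ker_map0_linear n m (f : hom n m) : linear (ker_map0 f).
Proof. by move=> c x y; apply: val_inj; rewrite /= linearP. Qed.
HB.instance Definition _ n m (f : hom n m) :=
  GRing.isLinear.Build k (kermod (e m)) (kermod (e n)) *:%R (ker_map0 f)
    (ker_map0_linear f).

Fact ker_map_id n x : ker_map0 (hid n) x = x.
Proof. by apply: val_inj; rewrite /= fmap_id. Qed.
Fact ker_map_comp n m p (b : hom m p) (a : hom n m) x :
  ker_map0 (hcomp b a) x = ker_map0 a (ker_map0 b x).
Proof. by apply: val_inj; rewrite /= fmap_comp. Qed.
Definition ker_fun : confun k :=
  @ConFun k (fun n => kermod (e n)) (fun n m f => ker_map0 f)
    ker_map_id ker_map_comp.

Definition ker_incl : nattrans ker_fun M :=
  @NatTrans k ker_fun M (fun n => (val : kermod (e n) -> M n)) (fun _ _ _ _ => erefl).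
End KernelFunctor.

Fixpoint syzygy M i : confun k :=
  if i is j.+1 then ker_fun (cover_aug (syzygy M j)) else M.

Definition ntcomp (X Y Z : confun k) (g : nattrans Y Z) (f : nattrans X Y) :
  nattrans X Z.
Proof.
by exists (fun n => g n \o f n) => n m a x /=; rewrite !ncompP.
Defined.

Lemma proj_resolution_exists M : inhabited (proj_resolution M).
Proof.
constructor.
exists (fun i => cover (syzygy M i))
  (fun i => ntcomp (ker_incl (cover_aug (syzygy M i))) (cover_aug (syzygy M i.+1)))
  (cover_aug M).
- by move=> i; exact: cover_projective.
- exact: cover_aug_surj.
- move=> n x; split=> [x0|[y ->]]; last exact: kermodP.
  have xk : kerpred (cover_aug M n) x by apply/eqP.
  have [y yx] := @cover_aug_surj (syzygy M 1) n (exist _ x xk).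
  by exists y; rewrite /= yx.
- move=> i n x; split=> [x0|[y ->]]; last first.
    exact: (congr1 val (kermodP (cover_aug (syzygy M i.+2) n y
      : kermod (cover_aug (syzygy M i.+1) n)))).
  have xk : kerpred (cover_aug (syzygy M i.+1) n) x.
    by apply/eqP/val_inj; exact: x0.
  have [y yx] := @cover_aug_surj (syzygy M i.+2) n (exist _ x xk).
  by exists y; rewrite /= yx.
Qed.

End Existence.

Section TensorHomology.
Variable k : comNzRingType.

Section TensorDS.
Variable N : covfun k.

Definition tens_sum (M : confun k) : lmodType k :=
  dsum (fun n => tens (M n) (N n)).
Definition sum_pure (M : confun k) n (y : M n) (x : N n) : tens_sum M :=
  din (F := fun n => tens (M n) (N n)) (pure y x).

Inductive tensDS_rel (M : confun k) : tens_sum M -> Prop :=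
| TensDSRel n m (f : hom n m) (y : M m) (x : N n) :
    tensDS_rel (sum_pure y (cmap N f x) - sum_pure (fmap M f y) x).

Definition tensDS (M : confun k) : lmodType k := qmod (@tensDS_rel M).

Section Map.
Variables (M M' : confun k) (e : nattrans M M').

Definition tensDS_map0 : {linear tens_sum M -> tensDS M'} :=
  qproj (@tensDS_rel M') \o
    (dmap (fun n => tens_map (N n) (e n)) : {linear tens_sum M -> tens_sum M'}).

Fact tensDS_map_rel u : tensDS_rel u -> tensDS_map0 u = 0.
Proof.
case=> n m f y x; rewrite /tensDS_map0 /= /sum_pure linearB /= !dmap_in.
by rewrite !tens_mapE ncompP; apply: qproj_eq0; constructor.
Qed.

Definition tensDS_map : {linear tensDS M -> tensDS M'} := qlift tensDS_map_rel.
End Map.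

Variables (M : confun k) (P : proj_resolution M).

(* The differential of P (x) N out of degree i; it is zero for i = 0. *)
Definition tor_d (i : nat) : {linear tensDS (P i) -> tensDS (P i.-1)} :=
  match i return {linear tensDS (P i) -> tensDS (P i.-1)} with
  | 0%N => \0
  | j.+1 => tensDS_map (res_d P j)
  end.

(* Tor_i(M, N), computed from the projective resolution P of M: the quotient
   of the i-cycles by the i-boundaries. *)
Definition Tor (i : nat) : lmodType k :=
  qmod (fun z : kermod (tor_d i) => exists y, val z = tor_d i.+1 y).

End TensorDS.
End TensorHomology.

Section SymmetricBar.
Variables (k : comNzRingType) (A : algType k).

Definition upd n (a : {ffun 'I_n.+1 -> A}) i (x : A) : {ffun 'I_n.+1 -> A} :=
  [ffun j => if j == i then x else a j].

Inductive tpow_rel n : {freeg {ffun 'I_n.+1 -> A} / k} -> Prop :=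
| TpowRel a i c (x y : A) :
    tpow_rel (gen k (upd a i (c *: x + y))
              - (c *: gen k (upd a i x) + gen k (upd a i y))).

(* The (n+1)-fold tensor power of A over k: formal combinations of families
   (a_0, ..., a_n) modulo multilinearity. *)
Definition tpow n : lmodType k := qmod (@tpow_rel n).
Definition ptens n (a : {ffun 'I_n.+1 -> A}) : tpow n :=
  qproj (@tpow_rel n) (gen k a).

Lemma ptens_linear n a i c (x y : A) :
  ptens (n := n) (upd a i (c *: x + y)) =
  c *: ptens (upd a i x) + ptens (upd a i y).
Proof.
by apply/eqP; rewrite /ptens -linearP -subr_eq0 -linearB qproj_eq0 //; constructor.
Qed.

Definition bar_act n m (f : hom n m) (a : {ffun 'I_n.+1 -> A}) :
    {ffun 'I_m.+1 -> A} :=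
  [ffun j => \prod_(i <- hord f j) a i].

Definition bar_map0 n m (f : hom n m) :
    {linear {freeg {ffun 'I_n.+1 -> A} / k} -> tpow m} :=
  flift (fun a => ptens (bar_act f a)).

Lemma bar_act_upd n m (f : hom n m) a i : exists u v : A, forall x,
  bar_act f (upd a i x) = upd (bar_act f a) (hmap f i) (u * x * v).
Proof.
have [s1 [s2 [E i1 i2]]] : exists s1 s2,
    [/\ hord f (hmap f i) = s1 ++ i :: s2, i \notin s1 & i \notin s2].
  have iin : i \in hord f (hmap f i) by rewrite mem_hord.
  have := hord_uniq f (hmap f i); case/splitPr: iin => s1 s2.
  rewrite cat_uniq /= negb_or => /and4P[_ /andP[i1 _] i2 _].
  by exists s1, s2.
have updN s x : i \notin s ->
    \prod_(j <- s) upd a i x j = \prod_(j <- s) a j.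
  move=> is_; apply: eq_big_seq => j js; rewrite ffunE.
  by case: eqP => // ji; rewrite -ji js in is_.
exists (\prod_(j <- s1) a j), (\prod_(j <- s2) a j) => x.
apply/ffunP => l; rewrite !ffunE; case: eqP => [->|/eqP li].
  by rewrite E big_cat big_cons /= !updN // ffunE eqxx mulrA.
by rewrite updN // mem_hord eq_sym.
Qed.

Fact bar_map_rel n m (f : hom n m) u : tpow_rel u -> bar_map0 f u = 0.
Proof.
case=> a i c x y; rewrite linearB linearP !fliftE.
have [p [q E]] := bar_act_upd f a i.
rewrite !E mulrDr mulrDl -scalerAr -scalerAl.
by rewrite ptens_linear subrr.
Qed.

Definition bar_map n m (f : hom n m) : {linear tpow n -> tpow m} :=
  qlift (@bar_map_rel n m f).

Lemma bar_mapE n m (f : hom n m) a : bar_map f (ptens a) = ptens (bar_act f a).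
Proof. by rewrite /bar_map /ptens qliftE fliftE. Qed.

Lemma tpow_ext n (W : lmodType k) (f g : {linear tpow n -> W}) :
  (forall a, f (ptens a) = g (ptens a)) -> f =1 g.
Proof.
move=> fg; elim/qmod_ind; apply: (@free_ext _ _ _ (f \o qproj _) (g \o qproj _)).
exact: fg.
Qed.

Fact bar_map_id n x : bar_map (hid n) x = x.
Proof.
apply: (@tpow_ext _ _ (bar_map (hid n)) idfun) => a; rewrite bar_mapE /=.
by congr ptens; apply/ffunP => j; rewrite !ffunE big_seq1.
Qed.

Fact bar_map_comp n m p (b : hom m p) (a : hom n m) x :
  bar_map (hcomp b a) x = bar_map b (bar_map a x).
Proof.
apply: (@tpow_ext _ _ (bar_map (hcomp b a)) (bar_map b \o bar_map a)) => c.
change (bar_map (hcomp b a) (ptens c) = bar_map b (bar_map a (ptens c))).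
rewrite !bar_mapE; congr ptens; apply/ffunP => j; rewrite !ffunE.
by rewrite big_flatten big_map; apply: eq_bigr => i _; rewrite ffunE.
Qed.

Definition Bsym : covfun k := CovFun bar_map_id bar_map_comp.

(* Symmetric homology of A, computed from the projective resolution P of the
   constant functor. *)
Definition HS (P : proj_resolution (cst_fun k)) (i : nat) : lmodType k :=
  Tor Bsym P i.

End SymmetricBar.

(* Main.v *)
From HB Require Import structures.
From mathcomp Require Import all_boot all_algebra.
From mathcomp Require Import zify boolp freeg.
Require Import Defs.

Set Implicit Arguments.
Unset Strict Implicit.
Unset Printing Implicit Defensive.

Import GRing.Theory.
Local Open Scope ring_scope.

(** Symmetric homology is finitely generated because the constant functor k on
    Delta S has a projective resolution by finite sums of representable
    functors. Tensoring a representable functor with the symmetric bar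
    construction gives a tensor power of A, which is finitely generated when A
    is; so the homology of the tensored resolution consists of subquotients of
    finitely generated modules over a noetherian ring [fin_gen_Tor], and two
    projective resolutions are chain homotopy equivalent [comparison],
    [homotopic_id].

    To resolve k by functors of finite type one needs that the iterated
    syzygies are generated in bounded arity. For a contravariant functor M on
    Delta S and a pair e = (x, y) of distinct elements of [n], let
    [contract e] be the idempotent endomorphism of [n] that merges y
    into x, right behind it. Elements of M n fixed by it come from [n-1]. More generally, a
    set of pairs that are the successor pairs of disjoint paths (a
    [path_system]) contracts each path to a point, and the elements of M n
    fixed by these contractions form a copy of the value of M at the quotient.
    Summing these modules over the path systems with q pairs gives a chain
    complex in q. Exactness at q = 0 makes M n generated by elements pulled back
    from [n-1] [contraction_generated]. Three facts decide where the complex is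
    exact.
    - For a representable functor of degree smaller than n it is exact
      everywhere [exact_at_free]: a basis element has a fiber with two
      elements, so it is fixed by some contraction, and a cone contracts the
      full simplex of the contractions that fix it.
    - For M = k it is the chain complex of the complex of path systems, the
      cycle-free chessboard complex, which is acyclic in degree q as soon as n
      is large compared to q [link_avoiding_acyclic].
    - It is an exact functor of M, since the elements fixed along a path
      system are split off naturally [contract_paths]. Hence exactness of M in
      degree q + 1 passes to exactness in degree q of the kernel of a cover of
      M by representable functors [exact_at_ker].
    So the property of being exact in each fixed degree in large arities
    [fp_infty] is inherited by syzygies, and it implies finite generation
    [fp_infty_fg]; iteration gives the resolution [finite_resolution]. *)

(** * Alternating chains *)

Section AlternatingChains.
Variables (E : finType) (V : zmodType).
Implicit Types (c b : seq E -> V) (e u : E) (s t : seq E).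

(** The value c t is the coefficient of the oriented simplex t. So the
    coefficient of t in the boundary of c is the sum of the c (e :: t), without
    signs. *)
Definition alternating c :=
  (forall s x y t, c (s ++ x :: y :: t) = - c (s ++ y :: x :: t)) /\
  (forall s x t, c (s ++ x :: x :: t) = 0).

Definition slice e c : seq E -> V := fun t => c (e :: t).

Definition bd c : seq E -> V := fun t => \sum_e c (e :: t).

Lemma alternating_slice e c : alternating c -> alternating (slice e c).
Proof.
by case=> c1 c2; split=> [s x y t|s x t]; [exact: (c1 (e :: s))|exact: (c2 (e :: s))].
Qed.

Lemma alternatingD c b : alternating c -> alternating b ->
  alternating (fun t => c t + b t).
Proof.
case=> c1 c2 [b1 b2]; split=> [s x y t|s x t].
  by rewrite c1 b1 opprD.
by rewrite c2 b2 addr0.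
Qed.

Lemma alternatingN c : alternating c -> alternating (fun t => - c t).
Proof.
by case=> c1 c2; split=> [s x y t|s x t]; [rewrite c1|rewrite c2 oppr0].
Qed.

Lemma alternating_sum (I : Type) (r : seq I) (P : pred I) (F : I -> seq E -> V) :
  (forall i, P i -> alternating (F i)) ->
  alternating (fun t => \sum_(i <- r | P i) F i t).
Proof.
move=> altF; split=> [s x y t|s x t].
  by rewrite -sumrN; apply: eq_bigr => i /altF [F1 _].
by rewrite big1 // => i /altF [_ F2].
Qed.

Lemma alternating_bd c : alternating c -> alternating (bd c).
Proof. by move=> altc; apply: alternating_sum => e _; exact: alternating_slice. Qed.

Lemma alternating_move0 c s x t : alternating c ->
  c (x :: s ++ t) = 0 -> c (s ++ x :: t) = 0.
Proof.
elim: s c => [|y s IHs] c altc //= c0.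
apply: (IHs (slice y c)); first exact: alternating_slice.
have [c1 _] := altc.
by rewrite /slice; have /= -> := c1 [::] y x (s ++ t); rewrite c0 oppr0.
Qed.

Lemma alternating_uniq c t : alternating c -> c t != 0 -> uniq t.
Proof.
elim: t c => //= x t IHt c altc cn0; apply/andP; split; last first.
  by apply: (IHt (slice x c)) => //; exact: alternating_slice.
apply: contra cn0 => /splitPr [s1 s2]; apply/eqP.
apply: (@alternating_move0 (slice x c)); first exact: alternating_slice.
by have [_ c2] := altc; exact: (c2 [::]).
Qed.

Lemma alternating_avoid (U : pred E) c t : alternating c ->
  (forall u s, U u -> c (u :: s) = 0) -> c t != 0 -> ~~ has U t.
Proof.
move=> altc c0; apply: contra => /hasP[u /splitPr [s1 s2] Uu].
by apply/eqP; apply: alternating_move0 => //; exact: c0.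
Qed.

(** The diagonal needs its own hypothesis because 2 may be a zero divisor. *)
Lemma sum_antisym (T : Type) (r : seq T) (f : T -> T -> V) :
  (forall x y, f x y = - f y x) -> (forall x, f x x = 0) ->
  \sum_(x <- r) \sum_(y <- r) f x y = 0.
Proof.
move=> f1 f2; elim: r => [|x r IHr]; first by rewrite big_nil.
rewrite big_cons; under [X in _ + X]eq_bigr do rewrite big_cons.
rewrite big_split /= IHr addr0 big_cons f2 add0r.
by rewrite -big_split big1 //= => y _; rewrite f1 addNr.
Qed.

Lemma bd_bd c t : alternating c -> bd (bd c) t = 0.
Proof.
case=> c1 c2; apply: sum_antisym => [x y|x]; first exact: (c1 [::]).
exact: (c2 [::]).
Qed.

Lemma bd_slice c u t : alternating c -> bd (slice u c) t = - bd c (u :: t).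
Proof. by case=> c1 _; rewrite -sumrN; apply: eq_bigr => e _; exact: (c1 [::]). Qed.

Lemma bdD c b t : bd (fun t => c t + b t) t = bd c t + bd b t.
Proof. exact: big_split. Qed.
Lemma bdN c t : bd (fun t => - c t) t = - bd c t.
Proof. exact: sumrN. Qed.
Lemma eq_bd c b t : c =1 b -> bd c t = bd b t.
Proof. by move=> cb; apply: eq_bigr => e _. Qed.

Section Wedge.
Variable p : E -> {additive V -> V}.

(** The sum over e of the exterior products of e with the image of c under
    p e, expanded along the position of e in the simplex. Cones and the
    contracting homotopy of a free functor have this form. *)
Fixpoint wedge c t : V :=
  if t is e :: t' then p e (c t') - wedge (slice e c) t' else 0.

Lemma wedge_sum (I : Type) (r : seq I) (F : I -> seq E -> V) t :
  wedge (fun t => \sum_(i <- r) F i t) t = \sum_(i <- r) wedge (F i) t.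
Proof.
elim: t F => [|e t IHt] F /=; first by rewrite big1.
by rewrite raddf_sum (IHt (fun i => slice e (F i))) -sumrB.
Qed.

Lemma eq_wedge c b : c =1 b -> wedge c =1 wedge b.
Proof.
move=> cb t; elim: t c b cb => //= e t IHt c b cb.
by rewrite cb (IHt _ (slice e b)) // => s; exact: cb.
Qed.

Lemma wedge0 t : wedge (fun=> 0) t = 0.
Proof. by elim: t => //= e t IHt; rewrite raddf0 (IHt) subrr. Qed.

(** The boundary is an antiderivation that sends each vertex to 1. *)
Lemma bd_wedge c t : bd (wedge c) t = \sum_e p e (c t) - wedge (bd c) t.
Proof. by rewrite /bd sumrB wedge_sum. Qed.

Lemma alternating_wedge c : alternating c -> alternating (wedge c).
Proof.
move=> altc; split=> [s x y t|s x t].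
  elim: s c altc => [|e s IHs] c altc; have [c1 c2] := altc.
    rewrite /= (@eq_wedge _ (fun s => - slice x (slice y c) s)); last first.
      by move=> s; exact: (c1 [::]).
    have -> : wedge (fun s => - slice x (slice y c) s) t
              = - wedge (slice x (slice y c)) t.
      elim: t (slice _ _) => [|e t IHt] b /=; first by rewrite oppr0.
      by rewrite (IHt (slice e b)) raddfN opprB addrC opprK.
    by rewrite /slice opprK opprB opprD addrA addrAC.
  by rewrite /= (IHs _ (alternating_slice e altc)) c1 raddfN opprB addrC opprK.
elim: s c altc => [|e s IHs] c altc; have [c1 c2] := altc.
  rewrite /= (@eq_wedge _ (fun=> 0)) ?wedge0 ?subr0 ?subrr //.
  by move=> s; exact: (c2 [::]).
by rewrite /= (IHs _ (alternating_slice e altc)) c2 raddf0 subrr.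
Qed.

(** The induction carries a prefix r, because the entries already consumed by
    the recursion defining the wedge product stay part of the simplex. *)
Lemma wedge_ind (Q R : seq E -> V -> Prop) :
  (forall t, R t 0) -> (forall t x y, R t x -> R t y -> R t (x - y)) ->
  (forall s e t x, Q (s ++ t) x -> R (s ++ e :: t) (p e x)) ->
  forall c, (forall t, Q t (c t)) -> forall t, R t (wedge c t).
Proof.
move=> R0 RB Rp c Qc t.
suff H : forall t' b r, (forall s, Q (r ++ s) (b s)) -> R (r ++ t') (wedge b t').
  exact: (H t c [::]).
elim=> [|e t' IHt] b r Qb /=; first exact: R0.
apply: RB; first exact/Rp/Qb.
by rewrite -cat_rcons; apply: IHt => s; rewrite cat_rcons; exact: Qb.
Qed.

End Wedge.

Definition only u e : {additive V -> V} :=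
  if e == u then (idfun : {additive V -> V}) else (\0 : {additive V -> V}).

Lemma sum_only u x : \sum_e only u e x = x.
Proof.
rewrite (bigD1 u) //= /only eqxx big1 ?addr0 //= => e /negPf ->.
by [].
Qed.

Lemma bd_cone u c t : bd (wedge (only u) c) t = c t - wedge (only u) (bd c) t.
Proof. by rewrite bd_wedge sum_only. Qed.

Definition chain (K : seq E -> Prop) q c :=
  alternating c /\ forall t, c t != 0 -> K t /\ size t = q.

Definition acyclic_at (K : seq E -> Prop) q := forall c, chain K q c ->
  (forall t, bd c t = 0) ->
  exists2 b, chain K q.+1 b & forall t, bd b t = c t.

Lemma chain_sub (K L : seq E -> Prop) q c :
  (forall t, K t -> L t) -> chain K q c -> chain L q c.
Proof. by move=> KL [altc cK]; split=> // t /cK[/KL]. Qed.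

Lemma chainD K q c b : chain K q c -> chain K q b -> chain K q (fun t => c t + b t).
Proof.
move=> [altc cK] [altb bK]; split=> [|t]; first exact: alternatingD.
by have [->|/cK //] := eqVneq (c t) 0; rewrite add0r => /bK.
Qed.

Lemma chainN K q c : chain K q c -> chain K q (fun t => - c t).
Proof.
by move=> [altc cK]; split=> [|t]; [exact: alternatingN | rewrite oppr_eq0 => /cK].
Qed.

Lemma chain_sum (I : finType) (P : pred I) K q (F : I -> seq E -> V) :
  (forall i, P i -> chain K q (F i)) ->
  chain K q (fun t => \sum_(i | P i) F i t).
Proof.
move=> chF; split=> [|t].
  by apply: alternating_sum => i /chF [].
case: (pickP (fun i => P i && (F i t != 0))) => [i /andP[/chF[_ iK] /iK] //|F0].
rewrite big1 ?eqxx // => i Pi; have := F0 i; rewrite Pi /=.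
by move/negbFE/eqP.
Qed.

Lemma chain_bd (K : seq E -> Prop) q c : (forall e t, K (e :: t) -> K t) ->
  chain K q.+1 c -> chain K q (bd c).
Proof.
move=> Kdown [altc cK]; split=> [|t]; first exact: alternating_bd.
case: (pickP (fun e => c (e :: t) != 0)) => [e /cK[/Kdown Kt [szt]]|c0] //.
by rewrite /bd big1 ?eqxx // => e _; have := c0 e; move/negbFE/eqP.
Qed.

Lemma chain_cone (K L : seq E -> Prop) u q c :
  (forall s t, L (s ++ t) -> K (s ++ u :: t)) ->
  chain L q c -> chain K q.+1 (wedge (only u) c).
Proof.
move=> LK [altc cL]; split; first exact: alternating_wedge.
apply: (wedge_ind (p := only u) (Q := fun t x => x != 0 -> L t /\ size t = q)
  (R := fun t x => x != 0 -> K t /\ size t = q.+1)) => // [t|t x y Rx Ry|s e t x].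
- by rewrite eqxx.
- by have [->|/Rx //] := eqVneq x 0; rewrite sub0r oppr_eq0 => /Ry.
- move=> Q; rewrite /only; case: ifP => [/eqP ->|_]; last by case/eqP.
  move=> /Q [Lst <-]; split; first exact: LK.
  by rewrite !size_cat addnS.
Qed.

(** Vertices in U are pairwise not joined by an edge of K, so that the chains
    of K modulo those avoiding U are the shifted chains of the links of the
    vertices in U. If c is a cycle, then its slice at u is a cycle of the link
    of u; if the slice bounds b, then adding the boundary of the wedge of u and
    b to c replaces the part of c that involves u by b, which avoids U. *)
Lemma push_off (K : seq E -> Prop) (U : pred E) (L : E -> seq E -> Prop) q c :
  (forall u t, U u -> uniq (u :: t) -> K (u :: t) -> L u t) ->
  (forall u s t, U u -> L u (s ++ t) -> K (s ++ u :: t)) ->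
  (forall u t, U u -> L u t -> K t /\ ~~ has U t) ->
  (forall u q', U u -> q = q'.+1 -> acyclic_at (L u) q') ->
  chain K q c -> (forall t, bd c t = 0) ->
  exists2 b, chain K q.+1 b &
    chain (fun t => K t /\ ~~ has U t) q (fun t => c t + bd b t).
Proof.
move=> KL LK LU Lac cK c0; have [altc cKq] := cK.
have slice0 u t : bd (slice u c) t = 0 by rewrite bd_slice // c0 oppr0.
have sliceL u : U u -> forall t, slice u c t != 0 -> L u t /\ (size t).+1 = q.
  move=> Uu t cut; have [Kut szt] := cKq _ cut; split=> //.
  by apply: KL => //; exact: (alternating_uniq altc cut).
have fill u : exists b, U u ->
    chain (L u) q b /\ forall t, bd b t = slice u c t.
  have [Uu|] := boolP (U u); last by exists (fun=> 0).
  case qE: q => [|q'].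
    exists (fun=> 0) => _; split=> [|t].
      by split=> [|t]; [split=> *; rewrite ?oppr0 | rewrite /= eqxx].
    rewrite /bd big1 //; apply/esym/eqP; apply: contraT.
    by move/(sliceL _ Uu) => []; rewrite qE.
  have [|b bL bdb] := Lac u q' Uu qE (slice u c) _ (slice0 u).
    split=> [|t /(sliceL u Uu)]; first exact: alternating_slice.
    by rewrite qE => -[? [?]].
  by exists b.
pose b u := sval (cid (fill u)).
have bP u : U u -> chain (L u) q (b u) /\ forall t, bd (b u) t = slice u c t.
  by rewrite /b; case: cid.
pose w t := \sum_(u | U u) wedge (only u) (b u) t.
have wK : chain K q.+1 w.
  apply: chain_sum => u Uu; have [bL _] := bP u Uu.
  by apply: chain_cone bL => s t; exact: LK.
have bdw t : bd w t = \sum_(u | U u) b u t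
                      - \sum_(u | U u) wedge (only u) (slice u c) t.
  rewrite /bd /w exchange_big -sumrB; apply: eq_bigr => u Uu /=.
  apply: etrans (bd_cone u (b u) t) _; congr (_ - _); apply: eq_wedge.
  by have [] := bP u Uu.
have slice_cone u : U u -> chain K q (wedge (only u) (slice u c)).
  move=> Uu; case qE: q => [|q']; last first.
    apply: (chain_cone (L := L u)) => [s t|]; first exact: LK.
    split=> [|t /(sliceL u Uu)]; first exact: alternating_slice.
    by rewrite qE => -[? [?]].
  split=> [|t]; first exact/alternating_wedge/alternating_slice.
  rewrite (@eq_wedge _ _ (fun=> 0)) ?wedge0 ?eqxx // => s.
  by apply/eqP; apply: contraT => /(sliceL u Uu) []; rewrite qE.
exists w => //.
pose c1 t := c t - \sum_(u | U u) wedge (only u) (slice u c) t.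
have c1K : chain K q c1 by apply: chainD => //; apply: chainN; exact: chain_sum.
have alt1 : alternating c1 by case: c1K.
have bK : chain (fun t => K t /\ ~~ has U t) q (fun t => \sum_(u | U u) b u t).
  apply: chain_sum => u Uu; apply: chain_sub (proj1 (bP u Uu)) => t; exact: LU.
suff c1U : chain (fun t => K t /\ ~~ has U t) q c1.
  have := chainD c1U bK; congr chain; apply: funext => t.
  by rewrite /c1 bdw addrAC addrA.
have [_ c1S] := c1K; split=> // t c1t; have [Kt szt] := c1S t c1t; split=> //.
split=> //; apply: (alternating_avoid (U := U)) c1t => // v s Uv.
have cc u x : U u -> c (u :: v :: x) = 0.
  move=> Uu; apply/eqP; apply: contraT => cn0; have [Kc _] := cKq _ cn0.
  have /LU [//|_ /=] := KL _ _ Uu (alternating_uniq altc cn0) Kc.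
  by rewrite Uv.
apply/eqP; rewrite subr_eq0; apply/eqP.
rewrite (bigD1 v) //= {1}/only eqxx /= big1 ?addr0 => [|u /andP[Uu uv]].
  rewrite (@eq_wedge _ _ (fun=> 0)) ?wedge0 ?subr0 // => x; exact: cc.
rewrite (@eq_wedge _ _ (fun=> 0)) ?wedge0 ?subr0 => [|x]; last exact: cc.
by rewrite /only eq_sym (negPf uv).
Qed.

End AlternatingChains.

(** * Path systems in a finite set *)

Section PathSystems.
Variable T : finType.
Implicit Types (w : seq T) (e : T * T) (t r : seq (T * T)).

Definition follows w e := exists s1 s2, w = s1 ++ e.1 :: e.2 :: s2.

(** The finite sets of ordered pairs that are the successor pairs of a disjoint
    union of directed paths: these are the faces of the cycle-free chessboard
    complex on T. *)
Definition path_system t : Prop :=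
  exists w, [/\ uniq w, forall x, x \in w & forall e, e \in t -> follows w e].

Lemma path_system_sub t t' : {subset t' <= t} -> path_system t -> path_system t'.
Proof. by move=> tt' [w [uw aw wt]]; exists w; split=> // e /tt' /wt. Qed.

Lemma uniq_split w s1 s2 s3 s4 x : uniq w -> w = s1 ++ x :: s2 ->
  w = s3 ++ x :: s4 -> s1 = s3 /\ s2 = s4.
Proof.
move=> uw e1 e2; have x1 : x \notin s1.
  by move: uw; rewrite e1 uniq_catC /= mem_cat negb_or => /andP[/andP[_ ]].
have x3 : x \notin s3.
  by move: uw; rewrite e2 uniq_catC /= mem_cat negb_or => /andP[/andP[_ ]].
have sz s s' : x \notin s -> index x (s ++ x :: s') = size s.
  by move=> xs; rewrite index_cat (negPf xs) /= eqxx addn0.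
have e3 : size s1 = size s3 by rewrite -(sz s1 s2) // -(sz s3 s4) // -e1 e2.
move: e1; rewrite e2 => /eqP; rewrite eqseq_cat // => /andP[/eqP -> /eqP[->]].
by [].
Qed.

Lemma follows_src w e e' : uniq w -> follows w e -> follows w e' ->
  e.1 = e'.1 -> e = e'.
Proof.
case: e e' => [a b] [a' b'] uw [s1 [s2 /= w1]] [s3 [s4 /= w2]] aa'.
by rewrite -aa' in w2 *; have [_ [->]] := uniq_split uw w1 w2.
Qed.

Lemma follows_tgt w e e' : uniq w -> follows w e -> follows w e' ->
  e.2 = e'.2 -> e = e'.
Proof.
case: e e' => [a b] [a' b'] uw [s1 [s2 /= w1]] [s3 [s4 /= w2]] aa'.
rewrite -aa' -cat_rcons in w1 *; rewrite -aa' -cat_rcons in w2.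
by have [/rcons_inj [_ ->]] := uniq_split uw w1 w2.
Qed.

Lemma follows_neq w e : uniq w -> follows w e -> e.1 != e.2.
Proof.
move=> uw [s1 [s2 we]]; move: uw; rewrite we cat_uniq => /and3P[_ _ /andP[]].
by rewrite inE negb_or => /andP[].
Qed.

(** If a starts no pair and b occurs in no pair, then b may be moved right
    behind a. *)
Lemma path_system_cons t a b : path_system t -> a != b ->
  (forall e, e \in t -> [/\ e.1 != a, e.1 != b & e.2 != b]) ->
  path_system ((a, b) :: t).
Proof.
move=> [w [uw aw wt]] ab free; pose w' := [seq x <- w | x != b].
have wt' e : e \in t -> follows w' e.
  move=> et; have [_ e1 e2] := free e et; have [s1 [s2 E]] := wt e et.
  exists [seq x <- s1 | x != b], [seq x <- s2 | x != b].
  by rewrite /w' E filter_cat /= e1 e2.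
have uw' : uniq w' by exact: filter_uniq.
have aw' x : (x \in w') = (x != b) by rewrite mem_filter aw andbT.
pose F s := flatten [seq if x == a then [:: a; b] else [:: x] | x <- s].
have F_id s : a \notin s -> F s = s.
  rewrite /F; elim: s => //= x s IHs; rewrite inE negb_or eq_sym => /andP[xa /IHs ->].
  by rewrite (negPf xa).
have Fcat s s' : F (s ++ s') = F s ++ F s' by rewrite /F map_cat flatten_cat.
have [s1 [s2 E1]] : exists s1 s2, w' = s1 ++ a :: s2.
  have : a \in w' by rewrite aw'.
  by case/splitPr=> s1 s2; exists s1, s2.
have E2 : F w' = s1 ++ a :: b :: s2.
  move: uw'; rewrite E1 uniq_catC /= mem_cat negb_or => /andP[/andP[a2 a1] _].
  by rewrite Fcat [F (a :: _)]/F /= eqxx /= -/(F s2) !F_id.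
have pF : perm_eq (F w') (b :: w').
  by rewrite E2 E1 -cat_rcons perm_catC /= perm_cons perm_catC cat_rcons.
exists (F w'); split.
- by rewrite (perm_uniq pF) /= uw' andbT aw' eqxx.
- by move=> x; rewrite (perm_mem pF) inE aw'; case: eqP.
move=> e; rewrite inE => /orP[/eqP -> /=|et]; first by exists s1, s2.
have [ea _ _] := free e et; have [s5 [s6 ->]] := wt' e et.
rewrite Fcat [F (e.1 :: _)]/F /= (negPf ea) /= -/(F s6).
rewrite /follows.
by case: eqP => [->|_]; [exists (F s5), (b :: F s6) | exists (F s5), (F s6)].
Qed.

Lemma fresh_vertex (s : seq T) : (size s < #|T|)%N -> exists x, x \notin s.
Proof.
move=> st; apply/existsP; apply: contraTT st; rewrite negb_exists => /forallP s_all.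
rewrite -leqNgt; apply: leq_trans (card_size s).
by apply: subset_leq_card; apply/subsetP => x _; rewrite -[_ \in _]negbK.
Qed.

(** The part of the link of the face r made of the pairs starting outside A.
    Links are described inside T, rather than by contracting the paths of r, so
    that links of links are again of this form on the same set T. *)
Definition link_avoiding r (A : seq T) t :=
  path_system (t ++ r) /\ forall e, e \in t -> e \notin r /\ e.1 \notin A.

Section Acyclicity.
Variable V : zmodType.
Implicit Types c : seq (T * T) -> V.

Lemma push_off_link r A (U : pred (T * T)) q c :
  (forall u, U u -> u \notin r /\ u.1 \notin A) ->
  (forall w u v, uniq w -> follows w u -> follows w v -> U u -> U v -> u = v) ->
  (forall u q', U u -> q = q'.+1 -> acyclic_at V (link_avoiding (u :: r) A) q') ->
  chain (link_avoiding r A) q c -> (forall t, bd c t = 0) ->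
  exists2 b, chain (link_avoiding r A) q.+1 b &
    chain (fun t => link_avoiding r A t /\ ~~ has U t) q (fun t => c t + bd b t).
Proof.
move=> UrA Uinc Uac cK c0.
apply: (push_off (L := fun u => link_avoiding (u :: r) A)) cK c0 => //.
- move=> u t Uu /= /andP[ut _] [ps sep]; split=> [|e et].
    by apply: path_system_sub ps => x; rewrite mem_cat !inE mem_cat orbCA orbA.
  have [er eA] := sep e (@mem_behead _ (u :: t) _ et).
  rewrite inE negb_or er eA; split=> //.
  by rewrite andbT; apply: contraNneq ut => <-.
- move=> u s t Uu [ps sep]; split=> [|e].
    apply: path_system_sub ps => x; rewrite !(mem_cat, inE).
    by case: (x \in s); case: (x == u); case: (x \in t); case: (x \in r).
  rewrite mem_cat inE orbCA -mem_cat => /orP[/eqP ->|/sep [er eA]]; first exact: UrA.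
  by move: er; rewrite inE negb_or => /andP[].
move=> u t Uu [ps sep]; split.
  split=> [|e /sep [er eA]]; last by move: er; rewrite inE negb_or => /andP[].
  apply: path_system_sub ps => x; rewrite !(mem_cat, inE).
  by case/orP=> ->; rewrite ?orbT.
apply/hasPn => e et; apply/negP => Ue; have [w [uw _ wt]] := ps.
have [er _] := sep e et; case/negP: er; rewrite inE; apply/orP; left; apply/eqP.
by apply: (Uinc w) => //; apply: wt; rewrite mem_cat ?et // inE eqxx orbT.
Qed.

(** Induction on q. Let a and b be two elements that occur neither in r nor in
    A. The links of the pairs starting at a, of those starting at b, and of
    those ending at b are complexes of the same kind, so a cycle can be pushed
    off these three sets of pairs in turn; then it lies in the complex of the
    faces that remain faces when (a, b) is added, and the cone with apex (a, b)
    fills it. Each of the links adds one pair to r and at most two elements to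
    A, which accounts for the coefficient 4 of q. *)
Theorem link_avoiding_acyclic q r A :
  (2 * size r + size A + 4 * q + 2 <= #|T|)%N ->
  acyclic_at V (link_avoiding r A) q.
Proof.
elim/ltn_ind: q r A => q IHq r A room c cK c0.
pose used := map fst r ++ map snd r ++ A.
have szu : ((size used).+1 < #|T|)%N by rewrite /used !size_cat !size_map; lia.
have [a a_new] : exists x, x \notin used by apply: fresh_vertex; lia.
have [b] : exists x, x \notin a :: used by exact: fresh_vertex.
rewrite inE negb_or => /andP[ba b_new].
have used_new x e : x \notin used ->
    [/\ x \notin A, e.1 == x -> e \notin r & e.2 == x -> e \notin r].
  rewrite /used !mem_cat !negb_or => /and3P[x1 x2 xA]; split=> // /eqP ex.
    by apply: contra x1; rewrite -ex => /(map_f fst).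
  by apply: contra x2; rewrite -ex => /(map_f snd).
have grow (u : T * T) (A' : seq T) q' : (size A' <= size A + 2)%N -> q = q'.+1 ->
    acyclic_at V (link_avoiding (u :: r) A') q'.
  move=> szA qq; have q1 : (q' < q)%N by rewrite qq.
  apply: IHq => /=; first exact: q1.
  move: szA room; rewrite qq.
  by move: (size A) (size A') (size r) #|T| => x y z w; lia.
have cycle c' d : alternating d -> (forall t, bd c' t = 0) ->
    forall t, bd (fun t => c' t + bd d t) t = 0.
  by move=> altd c'0 t; rewrite bdD c'0 bd_bd ?addr0.
have [aA ar _] := used_new a (a, a) a_new.
have [||u q' _|d1 d1K c1K] := @push_off_link r A (fun e => e.1 == a) q c _ _ _ cK c0.
- by move=> u ua; have [_ ur _] := used_new a u a_new; rewrite ur // (eqP ua).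
- move=> w u v uw wu wv /eqP ua /eqP va.
  by apply: follows_src wu wv _ => //; rewrite ua va.
- by apply: grow; lia.
have {}c1K : chain (link_avoiding r (a :: A)) q (fun t => c t + bd d1 t).
  apply: chain_sub c1K => t [[ps sep] /hasPn ta]; split=> // e et.
  by rewrite inE negb_or; have [-> ->] := sep e et; rewrite ta.
have c10 := cycle _ _ (proj1 d1K) c0.
have [bA _ _] := used_new b (b, b) b_new.
have bA1 : b \notin a :: A by rewrite inE negb_or ba.
have [||u q' _|d2 d2K c2K] :=
    @push_off_link r (a :: A) (fun e => e.1 == b) q _ _ _ _ c1K c10.
- by move=> u ub; have [_ ur _] := used_new b u b_new; rewrite ur // (eqP ub).
- move=> w u v uw wu wv /eqP ua /eqP va.
  by apply: follows_src wu wv _ => //; rewrite ua va.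
- by apply: grow; rewrite /=; lia.
have {}c2K : chain (link_avoiding r (b :: a :: A)) q
    (fun t => c t + bd d1 t + bd d2 t).
  apply: chain_sub c2K => t [[ps sep] /hasPn ta]; split=> // e et.
  by rewrite inE negb_or; have [-> ->] := sep e et; rewrite ta.
have c20 := cycle _ _ (proj1 d2K) c10.
have [||u q' _|d3 d3K c3K] := @push_off_link r (b :: a :: A)
    (fun e => (e.2 == b) && (e.1 \notin b :: a :: A)) q _ _ _ _ c2K c20.
- by move=> u /andP[ub uA]; have [_ _ ur] := used_new b u b_new; rewrite ur.
- move=> w u v uw wu wv /andP[/eqP ua _] /andP[/eqP va _].
  by apply: follows_tgt wu wv _ => //; rewrite ua va.
- by apply: grow; rewrite /=; lia.
have c30 := cycle _ _ (proj1 d3K) c20.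
pose c3 t := c t + bd d1 t + bd d2 t + bd d3 t.
have c3_cone : chain (link_avoiding r A) q.+1 (wedge (only V (a, b)) c3).
  apply: (chain_cone _ c3K) => s t [[ps sep] /hasPn st].
  have psab : path_system ((a, b) :: (s ++ t) ++ r).
    apply: path_system_cons ps _ _ => [|e]; first by rewrite eq_sym.
    rewrite mem_cat => /orP[est|er].
      have [_ eA] := sep e est; have := st e est; rewrite eA andbT => eb.
      by move: eA; rewrite !inE !negb_or => /and3P[].
    have [_ ra _] := used_new a e a_new; have [_ rb1 rb2] := used_new b e b_new.
    by split; apply/negP=> ex; [have := ra ex|have := rb1 ex|have := rb2 ex]; rewrite er.
  split=> [|e].
    apply: path_system_sub psab => x; rewrite !(mem_cat, inE).
    by case: (x \in s); case: (x == (a, b)); case: (x \in t); case: (x \in r).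
  rewrite mem_cat inE orbCA -mem_cat => /orP[/eqP ->|/sep [er]].
    by have [_ ra _] := used_new a (a, b) a_new; rewrite ra ?aA /=.
  by rewrite !inE !negb_or => /and3P[].
have widen x A' d : chain (link_avoiding r (x :: A')) q.+1 d ->
    chain (link_avoiding r A') q.+1 d.
  apply: chain_sub => t [ps sep]; split=> // e /sep [er].
  by rewrite inE negb_or => /andP[].
exists (fun t => wedge (only V (a, b)) c3 t + - d3 t + - d2 t + - d1 t).
  apply: chainD; last exact: chainN.
  apply: chainD; last exact/chainN/widen/d2K.
  by apply: chainD => //; exact/chainN/widen/widen/d3K.
move=> t; rewrite !bdD !bdN bd_cone (@eq_wedge _ _ _ _ (fun=> 0)) // wedge0 subr0.
by rewrite /c3 !addrK.
Qed.
End Acyclicity.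

End PathSystems.

(** * Contractions in Delta S *)

Section Contraction.
Variable n : nat.
Local Notation I := 'I_n.+1.
Implicit Types (e : I * I) (t : seq (I * I)).

Definition contract_val e : {ffun I -> I} * {ffun I -> seq I} :=
  ([ffun i => if i == e.2 then e.1 else i],
   [ffun j => if j == e.1 then undup [:: e.1; e.2]
              else if j == e.2 then [::] else [:: j]]).

Fact contract_ok e : hom_ok (contract_val e).
Proof.
case: e => x y; apply/forallP => j; rewrite !ffunE /=; apply/andP; split.
  case: ifP => _; first exact: (undup_uniq [:: x; y]).
  by case: ifP.
apply/forallP => i; rewrite !ffunE; apply/eqP.
have [->|jx] := eqVneq j x.
  rewrite (mem_undup [:: x; y] i) !inE.
  by have [->|_] := eqVneq i y; rewrite ?eqxx ?orbT ?orbF.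
move: jx; have [-> yx|jy jx] := eqVneq j y.
  have [->|iy] := eqVneq i y; last by rewrite (negPf iy).
  by rewrite eq_sym (negPf yx).
rewrite inE; have [->|//] := eqVneq i y.
by rewrite !(eq_sym _ j) (negPf jx) (negPf jy).
Qed.

(** This idempotent stands for the quotient of [n] in which e.1 and e.2 form
    one block: the elements that it fixes in M n are those pulled back from the
    quotient, and no identification of the quotient with [n-1] is needed. *)
Definition contract e : hom n n := Hom (contract_ok e).

Lemma hord_contract e j : hord (contract e) j =
  if j == e.1 then undup [:: e.1; e.2] else if j == e.2 then [::] else [:: j].
Proof. by rewrite ffunE. Qed.

Lemma hord_comp m p (b : hom m p) (a : hom n m) l :
  hord (hcomp b a) l = flatten [seq hord a j | j <- hord b l].
Proof. by rewrite ffunE. Qed.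

Lemma hord_eq m (a b : hom n m) : (forall j, hord a j = hord b j) -> a = b.
Proof.
move=> ab; apply: hom_ext; apply/ffunP => // i.
by apply/eqP; rewrite eq_sym -mem_hord -ab mem_hord.
Qed.

(** Replacing x by the word x y, and y by the empty word, leaves a word in which
    x and y only occur in the factor x y unchanged. *)
Lemma contract_head m (f : hom n m) l x y s : hord f l = x :: y :: s ->
  hcomp f (contract (x, y)) = f.
Proof.
move=> fl; have := hord_uniq f l; rewrite fl /= inE negb_or.
case/and3P=> /andP[xy xs] ys _.
have idw r : x \notin r -> y \notin r ->
    flatten [seq hord (contract (x, y)) j | j <- r] = r.
  elim: r => //= z r IHr; rewrite !inE !negb_or => /andP[xz xr] /andP[yz yr].
  by rewrite hord_contract /= !(eq_sym z) (negPf xz) (negPf yz) IHr.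
apply: hord_eq => j; rewrite hord_comp.
have [->|jl] := eqVneq j l.
  rewrite fl /= !hord_contract /= eqxx inE (negPf xy) /= eq_sym (negPf xy) eqxx /=.
  by rewrite idw.
have nj z : z \in [:: x, y & s] -> z \notin hord f j.
  by rewrite -fl !mem_hord => /eqP ->; rewrite eq_sym.
by rewrite idw // nj // !inE eqxx ?orbT.
Qed.

Lemma contract_idem e : e.1 != e.2 -> hcomp (contract e) (contract e) = contract e.
Proof.
case: e => x y /= xy; apply: (@contract_head _ _ x x y [::]).
by rewrite hord_contract /= eqxx inE (negPf xy).
Qed.

Lemma contract_follows m (f : hom n m) e : e.1 != e.2 ->
  hcomp f (contract e) = f -> follows (hord f (hmap f e.1)) e.
Proof.
case: e => x y /= xy fe; set l := hmap f x.
have xl : x \in hord f l by rewrite mem_hord.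
rewrite -fe hord_comp; case/splitPr: xl => s1 s2.
rewrite map_cat flatten_cat /= hord_contract /= eqxx inE (negPf xy) /=.
by exists (flatten [seq hord (contract (x, y)) j | j <- s1]),
  (flatten [seq hord (contract (x, y)) j | j <- s2]).
Qed.

Lemma contract_path_system m (f : hom n m) t :
  (forall e, e \in t -> e.1 != e.2 /\ hcomp f (contract e) = f) -> path_system t.
Proof.
move=> ft; exists (flatten [seq hord f j | j <- enum 'I_m.+1]); split.
- elim: (enum _) (enum_uniq 'I_m.+1) => //= j s IHs /andP[js us].
  rewrite cat_uniq hord_uniq IHs // andbT /=; apply/hasPn => i.
  case/flatten_mapP => j' j's; rewrite mem_hord => /eqP ij'; rewrite /= mem_hord.
  by rewrite ij'; apply: contraNneq js => <-.
- move=> i; apply/flatten_mapP; exists (hmap f i); first by rewrite mem_enum.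
  by rewrite mem_hord.
move=> e /ft [e12 fe]; have [s1 [s2 E]] := contract_follows e12 fe.
have : hmap f e.1 \in enum 'I_m.+1 by rewrite mem_enum.
case/splitPr=> r1 r2; rewrite map_cat flatten_cat /= E.
exists (flatten [seq hord f j | j <- r1] ++ s1), (s2 ++ flatten [seq hord f j | j <- r2]).
by rewrite -!catA.
Qed.

(** The composite of the contractions along t, those nearer to the head of a
    path being applied last, contracts each path to its head. Pulling back
    along it is a natural projection onto the elements fixed by all the
    contractions in t. *)
Lemma contract_paths t : path_system t -> exists phi : hom n n,
  (forall e, e \in t -> hcomp phi (contract e) = phi) /\
  (forall (k : comNzRingType) (M : confun k) (x : M n),
     (forall e, e \in t -> fmap M (contract e) x = x) -> fmap M phi x = x).
Proof.
case=> w [uw _ wt].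
suff [phi [phit phifix _ _]] : exists phi : hom n n,
  [/\ forall e, e \in t -> follows w e -> hcomp phi (contract e) = phi,
   (forall (k : comNzRingType) (M : confun k) (x : M n),
     (forall e, e \in t -> fmap M (contract e) x = x) -> fmap M phi x = x),
   forall z, z \notin w -> hord phi z = [:: z] &
   forall y w', w = y :: w' -> exists s, hord phi y = y :: s].
  by exists phi; split=> // e et; apply: phit => //; exact: wt.
elim: w uw {wt} => [|x w IHw].
  exists (hid n); split=> [e _ [[|? ?] [s]] //|k M x _|z _|//]; first exact: fmap_id.
  by rewrite ffunE.
case/andP=> xw /IHw [phi [phit phifix phi1 phih]].
have phix : hord phi x = [:: x] by exact: phi1.
have [[y [w' [wE xyt]]]|nxt] :
    (exists y w', w = y :: w' /\ (x, y) \in t) \/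
    (forall y w', w = y :: w' -> (x, y) \notin t).
- case: (w) => [|y w']; first by right.
  have [xyt|xyt] := boolP ((x, y) \in t); first by left; exists y, w'.
  by right=> ? ? [<-].
- have xy : x != y by move: xw; rewrite wE inE negb_or => /andP[].
  have [s phiy] := phih y w' wE.
  have psix : hord (hcomp (contract (x, y)) phi) x = x :: y :: s.
    by rewrite hord_comp hord_contract /= eqxx inE (negPf xy) /= phix phiy cats0.
  exists (hcomp (contract (x, y)) phi); split.
  + move=> e et [[|x' s1] [s2]] /=.
      rewrite wE => -[e1 e2 _]; rewrite (surjective_pairing e) -e1 -e2.
      exact: contract_head psix.
    by case=> _ we; rewrite -hcompA phit //; exists s1, s2.
  + by move=> k M z fz; rewrite fmap_comp fz // phifix.
  + move=> z; rewrite inE negb_or => /andP[zx zw]; rewrite hord_comp hord_contract /=.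
    rewrite (negPf zx) ifN /= ?cats0 ?phi1 //.
    by apply: contraNneq zw => ->; rewrite wE inE eqxx.
  + by move=> _ _ [<- _]; exists (y :: s).
- exists phi; split=> //.
  + move=> e et [[|x' s1] [s2]] /=; last by case=> _ we; apply: phit => //; exists s1, s2.
    by case=> e1 /nxt; rewrite e1 -surjective_pairing et.
  + by move=> z; rewrite inE negb_or => /andP[_ /phi1].
  + by move=> _ _ [<- _]; exists [::].
Qed.

End Contraction.

Section Factor.
Variable n : nat.
Implicit Types (x y : 'I_n.+2).

Definition skip_val y : {ffun 'I_n.+1 -> 'I_n.+2} * {ffun 'I_n.+2 -> seq 'I_n.+1} :=
  ([ffun i => fintype.lift y i],
   [ffun j => if unlift y j is Some i then [:: i] else [::]]).

Fact skip_ok y : hom_ok (skip_val y).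
Proof.
apply/forallP => j; rewrite !ffunE /=; apply/andP; split; first by case: unliftP.
apply/forallP => i; rewrite !ffunE; apply/eqP.
case: unliftP => [i' ->|->]; last by rewrite eq_sym (negPf (neq_lift _ _)).
by rewrite inE (inj_eq lift_inj).
Qed.

Definition merge_val y j0 : {ffun 'I_n.+2 -> 'I_n.+1} * {ffun 'I_n.+1 -> seq 'I_n.+2} :=
  ([ffun i => odflt j0 (unlift y i)],
   [ffun j => if j == j0 then [:: fintype.lift y j0; y] else [:: fintype.lift y j]]).

Fact merge_ok y j0 : hom_ok (merge_val y j0).
Proof.
apply/forallP => j; rewrite !ffunE /=; apply/andP; split.
  by case: ifP => //= _; rewrite inE eq_sym neq_lift.
apply/forallP => i; rewrite !ffunE; apply/eqP.
case: (unliftP y i) => [i' ->|->] /=.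
  have [->|jj0] := eqVneq j j0.
    by rewrite !inE (inj_eq lift_inj) (eq_sym _ y) (negPf (neq_lift _ _)) orbF.
  by rewrite inE (inj_eq lift_inj).
rewrite eq_sym; have [_|jj0] := eqVneq j j0; first by rewrite !inE eqxx orbT.
by rewrite inE (negPf (neq_lift _ _)).
Qed.

(** The element e.2 is not in the image of the contraction, which therefore
    factors through the object with one element less. *)
Lemma contract_factor (e : 'I_n.+2 * 'I_n.+2) : e.1 != e.2 ->
  exists (a : hom n.+1 n) (b : hom n n.+1), contract e = hcomp b a.
Proof.
case: e => x y /= xy; case: (unliftP y x) => [j0 xE|xE]; last by rewrite xE eqxx in xy.
exists (Hom (merge_ok y j0)), (Hom (skip_ok y)); apply: hord_eq => j.
rewrite hord_comp hord_contract /= !ffunE.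
case: (unliftP y j) => [i ->|->] /=; last by rewrite eq_sym (negPf xy) eqxx.
rewrite cats0 ffunE xE (inj_eq lift_inj) inE.
have [_|_] := eqVneq i j0; first by rewrite (eq_sym _ y) (negPf (neq_lift _ _)).
by rewrite (eq_sym _ y) (negPf (neq_lift _ _)).
Qed.

End Factor.

(** * Complexes of contractions of a functor *)

Section ContractionComplex.
Variable k : comNzRingType.
Implicit Type M : confun k.

Definition contracted M n (t : seq ('I_n.+1 * 'I_n.+1)) (x : M n) : Prop :=
  forall e, e \in t -> fmap M (contract e) x = x.

(** The coefficient at a simplex lies in the part of M n fixed by the
    contractions in the simplex, a copy of the value of M at the quotient of
    [n] by the paths of the simplex. *)
Definition contraction_chain M n q (c : seq ('I_n.+1 * 'I_n.+1) -> M n) : Prop :=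
  chain (@path_system _) q c /\ forall t, contracted t (c t).

Definition exact_at M n q := forall z, @contraction_chain M n q z ->
  (forall t, bd z t = 0) ->
  exists2 c, @contraction_chain M n q.+1 c & forall t, bd c t = z t.

(** Contractions act trivially on a constant functor, so its complex is that of
    all path systems. *)
Lemma exact_at_cst q n : (4 * q + 2 <= n.+1)%N -> exact_at (cst_fun k) n q.
Proof.
move=> qn z [zP _] z0.
have pl t : path_system t <-> link_avoiding [::] [::] t.
  by rewrite /link_avoiding cats0; split=> [|[]].
have [||c cP cz] := @link_avoiding_acyclic _ (k^o) q [::] [::] _ z _ z0.
- by rewrite card_ord.
- by apply: chain_sub zP => t /pl.
by exists c => //; split=> //; apply: chain_sub cP => t /pl.
Qed.

Lemma contractedB M n t (x y : M n) :
  contracted t x -> contracted t y -> contracted t (x - y).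
Proof. by move=> xt yt e et; rewrite linearB /= xt ?yt. Qed.

Lemma contracted0 M n t : contracted t (0 : M n).
Proof. by move=> e et; rewrite linear0. Qed.

End ContractionComplex.

(** * Free functors *)

Section FreeFunctor.
Variables (k : comNzRingType) (J : choiceType) (deg : J -> nat).

Definition free_basis n : choiceType := {j : J & hom n (deg j)}.
Definition fbas n j (a : hom n (deg j)) : free_basis n :=
  existT (fun j => hom n (deg j)) j a.
Definition fbas_act n m (f : hom n m) (b : free_basis m) : free_basis n :=
  fbas (hcomp (tagged b) f).

Lemma fbas_act_id n (b : free_basis n) : fbas_act (hid n) b = b.
Proof. by case: b => j a; rewrite /fbas_act hcomp1. Qed.

Lemma fbas_act_comp n m p (g : hom m p) (f : hom n m) b :
  fbas_act (hcomp g f) b = fbas_act f (fbas_act g b).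
Proof. by rewrite /fbas_act hcompA. Qed.

Definition free_map n m (f : hom n m) :
    {linear {freeg (free_basis m) / k} -> {freeg (free_basis n) / k}} :=
  flift (fun b => gen k (fbas_act f b)).

Lemma free_mapE n m (f : hom n m) b :
  free_map f (gen k b) = gen k (fbas_act f b).
Proof. exact: fliftE. Qed.

Fact free_map_id n x : free_map (hid n) x = x.
Proof.
apply: (@free_ext _ _ _ (free_map (hid n)) idfun) => b.
by rewrite free_mapE fbas_act_id.
Qed.

Fact free_map_comp n m p (g : hom m p) (f : hom n m) x :
  free_map (hcomp g f) x = free_map f (free_map g x).
Proof.
apply: (@free_ext _ _ _ (free_map (hcomp g f)) (free_map f \o free_map g)) => b.
by rewrite /= !free_mapE fbas_act_comp.
Qed.

Definition free_functor : confun k :=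
  @ConFun k (fun n => {freeg (free_basis n) / k}) free_map free_map_id free_map_comp.

Section Extension.
Variables (N : confun k) (g : forall j, N (deg j)).

Definition free_lift n : {linear free_functor n -> N n} :=
  flift (fun b : free_basis n => fmap N (tagged b) (g (tag b))).

Lemma free_liftE n (b : free_basis n) :
  free_lift n (gen k b) = fmap N (tagged b) (g (tag b)).
Proof. exact: fliftE. Qed.

Lemma free_lift_nat n m (f : hom n m) (x : free_functor m) :
  free_lift n (fmap free_functor f x) = fmap N f (free_lift m x).
Proof.
apply: (@free_ext _ _ _ (free_lift n \o free_map f) (fmap N f \o free_lift m)) => b.
by rewrite /= free_mapE !free_liftE fmap_comp.
Qed.

Definition free_ext_nat : nattrans free_functor N := NatTrans free_lift_nat.

End Extension.

Lemma free_projective : projective free_functor.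
Proof.
move=> M N e g esurj.
pose b j : free_functor (deg j) := gen k (fbas (hid (deg j))).
pose h j := sval (cid (esurj _ (g _ (b j)))).
have hP j : e _ (h j) = g _ (b j) by rewrite /h; case: cid.
exists (free_ext_nat h) => n x.
apply: (@free_ext _ _ _ (e n \o free_lift h n) (g n)) => -[j a].
rewrite /= (free_liftE h (existT _ j a)) ncompP hP -ncompP /=.
by rewrite free_mapE /fbas_act hcomp1l.
Qed.

Section Exactness.
Variable n : nat.
Local Notation E := ('I_n.+1 * 'I_n.+1)%type.
Implicit Types (b : free_basis n) (e : E) (t : seq E).

(** Contractions are idempotent and map basis elements to basis elements, so the
    elements they fix are spanned by basis elements, and the projections that
    matter are diagonal. *)
Definition diag (d : pred (free_basis n)) :
    {linear free_functor n -> free_functor n} :=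
  flift (fun b => if d b then gen k b else 0).

Lemma diagE d b : diag d (gen k b) = if d b then gen k b else 0.
Proof. exact: fliftE. Qed.

Lemma diag_comp d1 d2 x : diag d1 (diag d2 x) = diag (predI d1 d2) x.
Proof.
apply: (@free_ext _ _ _ (diag d1 \o diag d2) (diag (predI d1 d2))) => b.
by rewrite /= !diagE /= andbC; case: (d2 b); rewrite ?linear0 // diagE.
Qed.

Lemma eq_diag d1 d2 : d1 =1 d2 -> diag d1 =1 diag d2.
Proof. by move=> d12; apply: free_ext => b; rewrite !diagE d12. Qed.

Lemma diagC d1 d2 x : diag d1 (diag d2 x) = diag d2 (diag d1 x).
Proof. by rewrite !diag_comp; apply: eq_diag => b; rewrite /= andbC. Qed.

Definition joins e : pred (free_basis n) :=
  fun b => (e.1 != e.2) && (fbas_act (contract e) b == b).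

Lemma contract_diag e x : fmap free_functor (contract e) (diag (joins e) x)
  = diag (joins e) x.
Proof.
apply: (@free_ext _ _ _ (free_map (contract e) \o diag (joins e)) (diag (joins e))) => b.
rewrite /= diagE; case: ifP => [/andP[_ /eqP be]|_]; last exact: linear0.
by rewrite free_mapE be.
Qed.

Lemma diag_contract e x : e.1 != e.2 ->
  fmap free_functor (contract e) x = x -> diag (joins e) x = x.
Proof.
move=> ee <-; apply: (@free_ext _ _ _ (diag (joins e) \o free_map (contract e))
  (free_map (contract e))) => b.
rewrite /= free_mapE diagE /joins ee -fbas_act_comp contract_idem //.
by rewrite eqxx.
Qed.

Lemma diag_path_system t x : (forall e, e \in t -> diag (joins e) x = x) ->
  x != 0 -> path_system t.
Proof.
move=> xt xn0.
have xall : x = diag (fun b => all (joins^~ b) t) x.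
  elim: t xt => [|e t IHt] xt.
    apply/esym; apply: (@free_ext _ _ _ (diag _) idfun) => b.
    by rewrite diagE.
  rewrite [in LHS]IHt => [|e' e't]; last by rewrite xt // inE e't orbT.
  rewrite -[in LHS](xt e) ?mem_head // diag_comp.
  by apply: eq_diag => b; rewrite /= andbC.
have [[[j a] /allP bt]|nb] := EM (exists b, all (joins^~ b) t).
  apply: (@contract_path_system _ _ a) => e /bt /andP[ee].
  move/(etrans (esym (@eq_Tagged _ (fun j => hom n (deg j)) (fbas _) a))) => /eqP.
  by [].
case/eqP: xn0; rewrite xall; apply: (@free_ext _ _ _ (diag _) \0) => b.
by rewrite diagE; case: ifP => // bt; case: nb; exists b.
Qed.

Hypothesis deg_lt : forall j, (deg j < n)%N.

Lemma joins_exists b : exists e, joins e b.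
Proof.
case: b => j a.
have [[l [x [y [s al]]]]|none] :
  (exists l x y s, hord a l = x :: y :: s) \/ forall l, (size (hord a l) <= 1)%N.
- have [?|none] := EM (exists l x y s, hord a l = x :: y :: s); [by left|right=> l].
  by case E: (hord a l) => [|x [|y s]] //; case: none; exists l, x, y, s.
- exists (x, y); have := hord_uniq a l; rewrite al /= inE negb_or.
  case/and3P=> /andP[xy _] _ _; rewrite /joins xy /fbas_act /=.
  by rewrite (contract_head al).
have inj : injective (hmap a).
  move=> x y xy; have : x \in hord a (hmap a y) by rewrite mem_hord xy.
  have : y \in hord a (hmap a y) by rewrite mem_hord.
  case: (hord a (hmap a y)) (none (hmap a y)) => [|z [|]] // _.
  by rewrite !inE => /eqP -> /eqP ->.
by have := leq_card _ inj; rewrite !card_ord ltnS leqNgt deg_lt.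
Qed.

(** Choosing for every basis element b a contraction that fixes b defines a cone
    on the full simplex of the contractions fixing b. The projections p e onto
    the basis elements with choice e assemble these cones into a homotopy. *)
Theorem exact_at_free q : exact_at free_functor n q.
Proof.
move=> z [[altz zq] zt] z0.
pose pick b : E := xchoose (joins_exists b).
have pickP b : joins (pick b) b by exact: (xchooseP (joins_exists b)).
pose p e : {linear free_functor n -> free_functor n} := diag (fun b => pick b == e).
have zdiag t : (z t != 0 -> size t = q) /\
    forall e, e \in t -> diag (joins e) (z t) = z t.
  have [->|/[dup] ztn /zq [[w [uw _ wt]] szt]] := eqVneq (z t) 0.
    by split=> // e _; rewrite linear0.
  by split=> // e et; apply: diag_contract (zt t e et); exact: follows_neq uw (wt e et).
have wdiag t : (wedge p z t != 0 -> size t = q.+1) /\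
    forall e, e \in t -> diag (joins e) (wedge p z t) = wedge p z t.
  move: t; apply: (wedge_ind (Q := fun t x => (x != 0 -> size t = q) /\
    forall e, e \in t -> diag (joins e) x = x)
    (R := fun t x => (x != 0 -> size t = q.+1) /\
    forall e, e \in t -> diag (joins e) x = x) (p := p)) => //.
  - by move=> t; split=> [|e _]; rewrite ?eqxx ?linear0.
  - move=> t x y [xq xt] [yq yt]; split=> [|e et]; last by rewrite linearB /= xt // yt.
    by have [->|/xq //] := eqVneq x 0; rewrite sub0r oppr_eq0.
  - move=> s e t x [xq xt]; split=> [|e'].
      have [->|/xq + _] := eqVneq x 0; first by rewrite raddf0 eqxx.
      by rewrite !size_cat /= addnS => ->.
    rewrite mem_cat inE orbCA -mem_cat => /orP[/eqP ->|e't]; last by rewrite diagC xt.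
    rewrite diag_comp; apply: eq_diag => b /=.
    by case: eqP => [<-|]; rewrite ?pickP ?andbF.
exists (wedge p z).
  split=> [|t e et].
    split=> [|t wn0]; first exact: alternating_wedge.
    have [szt wt] := wdiag t; split; last exact: szt.
    exact: diag_path_system wt wn0.
  by have [_ wt] := wdiag t; rewrite -(wt e et) contract_diag.
move=> t; rewrite bd_wedge (@eq_wedge _ _ _ _ (fun=> 0)) // wedge0 subr0.
rewrite [in RHS](freegE (z t)) (eq_bigr _ (fun e _ => congr1 (p e) (freegE (z t)))).
under eq_bigr do rewrite linear_sum; rewrite exchange_big; apply: eq_bigr => b _ /=.
under eq_bigr do rewrite linearZ /= diagE; rewrite -scaler_sumr; congr (_ *: _).
rewrite (bigD1 (pick b)) //= eqxx big1 ?addr0 // => e.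
by rewrite eq_sym => /negPf ->.
Qed.

End Exactness.
End FreeFunctor.

(** * Lifting alternating chains *)

Section AlternatingLift.
Variables (E : finType) (k : comNzRingType).
Implicit Types (s t : seq E).

Fixpoint inversions s : nat :=
  if s is x :: s' then count (fun z => enum_rank z < enum_rank x)%N s' + inversions s'
  else 0.

Lemma inversions_swap s x y t : x != y ->
  odd (inversions (s ++ x :: y :: t)) = ~~ odd (inversions (s ++ y :: x :: t)).
Proof.
move=> xy; elim: s => [|z s IHs] /=.
  have : (enum_rank x : nat) != enum_rank y.
    by apply: contraNneq xy => /val_inj/enum_rank_inj ->.
  rewrite !oddD; set p := odd (count _ t); set q := odd (count _ t).
  by case: ltngtP => //= _ _; case: p; case: q; case: (odd (inversions t)).
rewrite !oddD IHs addbN; congr (~~ (odd _ (+) _)).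
by rewrite !count_cat /= (addnCA (_ < _)%N).
Qed.

Lemma perm_eq_swap (X : Type) (v : seq E -> X) s t :
  (forall s x y t, v (s ++ x :: y :: t) = v (s ++ y :: x :: t)) ->
  perm_eq s t -> v s = v t.
Proof.
move=> vs; have front r x r' : v (r ++ x :: r') = v (x :: r ++ r').
  elim/last_ind: r r' => // r y IHr r'.
  by rewrite -cats1 -!catA /= vs IHr.
elim: s t v vs front => [|x s IHs] t v vs front.
  by rewrite perm_sym => /perm_nilP ->.
move=> st; have xt : x \in t by rewrite -(perm_mem st) mem_head.
case/splitPr: xt st => t1 t2; rewrite perm_sym perm_catC /= perm_cons => st.
rewrite front; apply: (IHs _ (fun s => v (x :: s))).
- by move=> r y z r'; exact: (vs (x :: r)).
- by move=> r y r'; have /= -> := front (x :: r) y r'; exact: (vs [::]).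
by rewrite perm_sym (perm_trans _ st) // perm_catC.
Qed.

(** A chain is determined by its values on one ordering of each simplex, up to
    the sign of the ordering. *)
Lemma alternating_lift (V W : lmodType k) (p : {linear V -> W})
    (P : seq E -> V -> Prop) (c : seq E -> W) :
  (forall s t y, perm_eq s t -> P s y -> P t y) ->
  (forall t y, P t y -> P t (- y)) -> (forall t, P t 0) ->
  (forall t, exists2 y, P t y & p y = c t) -> alternating c ->
  exists b, [/\ alternating b, forall t, P t (b t) & forall t, p (b t) = c t].
Proof.
move=> Pperm PN P0 lifts altc; pose sg t : k := (-1) ^+ inversions t.
pose canon t := enum [set x in t].
have canonP t : uniq t -> perm_eq t (canon t).
  by move=> ut; apply: uniq_perm; rewrite ?enum_uniq // => x; rewrite mem_enum inE.
have canonE s t : perm_eq s t -> canon s = canon t.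
  by move=> st; apply: eq_enum => x; rewrite !inE (perm_mem st).
have sgsg t (x : W) : sg t *: (sg t *: x) = x.
  by rewrite scalerA -expr2 sqrr_sign scale1r.
have sgP t y s : P s y -> P s (sg t *: y).
  by rewrite /sg -signr_odd; case: odd; rewrite ?scaleN1r ?scale1r //; exact: PN.
pose y t := s2val (cid2 (lifts (canon t))).
have yP t : P (canon t) (y t) by rewrite /y; case: cid2.
have yc t : p (y t) = c (canon t) by rewrite /y; case: cid2.
have cperm s t : perm_eq s t -> sg s *: c s = sg t *: c t.
  apply: (perm_eq_swap (v := fun s => sg s *: c s)) => {}s x z {}t.
  have [-> //|xz] := eqVneq x z; rewrite (proj1 altc) /sg.
  rewrite -[in LHS]signr_odd (inversions_swap _ _ xz) signrN signr_odd.
  by rewrite scalerN scaleNr opprK.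
exists (fun t => if uniq t then sg t *: (sg (canon t) *: y t) else 0); split.
- split=> [s x z t|s x t]; last first.
    by rewrite ifN // uniq_catC cat_uniq /= negb_and inE eqxx.
  have st : perm_eq (s ++ x :: z :: t) (s ++ z :: x :: t).
    by rewrite perm_cat2l; apply/permP => Q /=; rewrite addnCA.
  rewrite (perm_uniq st); case: ifP => ust; last by rewrite oppr0.
  have xz : x != z.
    move: ust; rewrite cat_uniq => /and3P[_ _ /andP[]].
    by rewrite inE negb_or eq_sym => /andP[].
  rewrite /y (canonE _ _ st) /sg -[in LHS]signr_odd (inversions_swap _ _ xz).
  by rewrite signrN signr_odd scaleNr.
- move=> t; case: ifP => // ut; apply/sgP/sgP.
  by apply: Pperm (yP t); rewrite perm_sym canonP.
- move=> t; case: ifP => [ut|nut].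
    by rewrite !linearZ /= yc -(cperm _ _ (canonP t ut)) sgsg.
  rewrite linear0; apply/esym/eqP; apply: contraFT nut.
  exact: alternating_uniq.
Qed.

End AlternatingLift.

(** * Syzygies *)

Section Syzygy.
Variables (k : comNzRingType) (F M : confun k) (e : nattrans F M).
Hypothesis e_surj : pointwise_surj e.
Variable n : nat.

Lemma contraction_chain_lift q c : contraction_chain (M := M) (n := n) q c ->
  exists2 b, contraction_chain (M := F) q b & forall t, e n (b t) = c t.
Proof.
move=> [[altc cq] ct].
have [||||b [altb bP bc]] := alternating_lift (p := e n) (c := c)
  (P := fun t y => (y != 0 -> path_system t /\ size t = q) /\ contracted t y)
  _ _ _ _ altc.
- move=> s t y st [yq ys]; split=> [/yq [ps <-]|u ut]; last first.
    by apply: ys; rewrite (perm_mem st).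
  rewrite (perm_size st); split=> //.
  by apply: path_system_sub ps => x; rewrite (perm_mem st).
- move=> t y [yq yt]; split; first by rewrite oppr_eq0.
  by rewrite -sub0r; apply: contractedB => //; exact: contracted0.
- by move=> t; split; [rewrite eqxx | exact: contracted0].
- move=> t; have [->|/cq [ps szt]] := eqVneq (c t) 0.
    by exists 0; rewrite ?linear0 //; split; [rewrite eqxx | exact: contracted0].
  have [phi [phit phifix]] := contract_paths ps; have [y yc] := e_surj (c t).
  exists (fmap F phi y); last by rewrite ncompP yc phifix //; exact: ct.
  by split=> // u ut; rewrite -fmap_comp phit.
exists b => //; split=> [|t]; last by have [] := bP t.
by split=> // t; have [] := bP t.
Qed.

(** The long exact sequence of the complexes of contractions of the kernel, of
    F and of M. *)
Theorem exact_at_ker q : exact_at F n q -> exact_at M n q.+1 ->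
  exact_at (ker_fun e) n q.
Proof.
move=> exF exM z [[altz zq] zt] z0; pose i := ker_incl e n.
have i_inj : injective i by exact: val_inj.
have i_chain p (c : seq _ -> ker_fun e n) : contraction_chain p c ->
    contraction_chain (M := F) p (fun t => i (c t)).
  move=> [[[c1 c2] cp] ct]; split=> [|t u ut]; last by rewrite -[in RHS](ct t u ut).
  split=> [|t cn0]; last by apply: cp; apply: contraNneq cn0 => ->; rewrite linear0.
  by split=> [s a b t|s a t]; [rewrite c1 linearN | rewrite c2 linear0].
have bd_i (c : seq _ -> ker_fun e n) t : bd (fun t => i (c t)) t = i (bd c t).
  by rewrite /bd linear_sum.
have [|w [[altw wq] wt] wz] := exF _ (i_chain q z (conj (conj altz zq) zt)).
  by move=> t; rewrite bd_i z0 linear0.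
have bd_e b t : bd (fun t => e n (b t)) t = e n (bd b t).
  by rewrite /bd linear_sum.
have ewM : contraction_chain (M := M) q.+1 (fun t => e n (w t)).
  split=> [|t u ut]; last by rewrite -ncompP wt.
  split=> [|t ewt]; last by apply: wq; apply: contraNneq ewt => ->; rewrite linear0.
  have [w1 w2] := altw.
  by split=> [s a b t|s a t]; [rewrite w1 linearN | rewrite w2 linear0].
have [|u uM uw] := exM _ ewM; first by move=> t; rewrite bd_e wz kermodP.
have [v [[altv vq] vt] vu] := contraction_chain_lift uM.
have kerP t : kerpred (e n) (w t - bd v t).
  by apply/eqP; rewrite linearB /= -bd_e (eq_bd _ vu) uw subrr.
pose x t : ker_fun e n := exist (fun y => kerpred (e n) y) _ (kerP t) : kermod (e n).
have ix t : i (x t) = w t - bd v t by [].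
have [[wv1 wv2] wvq] : chain (@path_system _) q.+1 (fun t => w t + - bd v t).
  apply: chainD => //; apply: chainN; apply: chain_bd => // u' t.
  by apply: path_system_sub => y; rewrite inE => ->; rewrite orbT.
exists x; last first.
  by move=> t; apply: i_inj; rewrite -bd_i (eq_bd _ ix) bdD bdN bd_bd // oppr0 addr0.
split=> [|t u' u't]; last first.
  apply: i_inj; rewrite ncompP ix; apply: (@contractedB _ _ _ t) u' u't => // u' u't.
  rewrite /bd linear_sum; apply: eq_bigr => f _; apply: vt.
  by rewrite inE u't orbT.
split=> [|t xn0]; last first.
  apply: wvq; rewrite -ix; apply: contra_neq xn0 => ix0.
  by apply: i_inj; rewrite ix0 linear0.
by split=> [s a b t|s a t]; apply: i_inj; rewrite ?linearN ?linear0 !ix ?wv2 // wv1.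
Qed.

End Syzygy.

(** * Finitely generated modules *)

Section FinGen.
Variable k : comNzRingType.
Implicit Types V W : lmodType k.

Fixpoint in_span V (s : seq V) (x : V) : Prop :=
  if s is v :: s' then exists a y, in_span s' y /\ x = a *: v + y else x = 0.

Lemma in_spanP V (s : seq V) x :
  in_span s x <-> exists c : 'I_(size s) -> k, x = \sum_(i < size s) c i *: s`_i.
Proof.
elim: s x => [|v s IHs] x /=.
  by split=> [->|[c ->]]; [exists (fun=> 0)|]; rewrite big_ord0.
split=> [[a [y [/IHs [c ->] ->]]]|[c ->]]; last first.
  rewrite big_ord_recl /=; exists (c ord0).
  exists (\sum_(i < size s) c (fintype.lift ord0 i) *: s`_i); split=> //.
  by apply/IHs; exists (fun i => c (fintype.lift ord0 i)).
exists (fun i => if unlift ord0 i is Some j then c j else a).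
rewrite big_ord_recl unlift_none; congr (_ + _).
by apply: eq_bigr => i _; rewrite liftK.
Qed.

Lemma fin_genP V : fin_gen V <-> exists s : seq V, forall x, in_span s x.
Proof. by split=> -[s sP]; exists s => x; apply/in_spanP. Qed.

Lemma in_span0 V (s : seq V) : in_span s 0.
Proof. by elim: s => //= v s IHs; exists 0, 0; rewrite scale0r addr0. Qed.

Lemma in_spanP_lin V (s : seq V) a x y :
  in_span s x -> in_span s y -> in_span s (a *: x + y).
Proof.
elim: s x y => [|v s IHs] x y /=; first by move=> -> ->; rewrite scaler0 addr0.
move=> [b [x' [sx ->]]] [c [y' [sy ->]]]; exists (a * b + c), (a *: x' + y').
split; first exact: IHs.
by rewrite scalerDr scalerA scalerDl !addrA; congr (_ + _); rewrite addrAC.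
Qed.

Lemma in_spanZ V (s : seq V) a x : in_span s x -> in_span s (a *: x).
Proof. by move=> sx; rewrite -[_ *: _]addr0; exact/in_spanP_lin/in_span0. Qed.

Lemma in_spanD V (s : seq V) x y : in_span s x -> in_span s y -> in_span s (x + y).
Proof. by move=> sx sy; rewrite -[x]scale1r; exact: in_spanP_lin. Qed.

Lemma in_span_sum V (s : seq V) (I : eqType) (r : seq I) (F : I -> V) :
  (forall i, i \in r -> in_span s (F i)) -> in_span s (\sum_(i <- r) F i).
Proof.
move=> sF; rewrite big_seq; elim/big_ind: _ => //; first exact: in_span0.
exact: in_spanD.
Qed.

Lemma mem_in_span V (s : seq V) v : v \in s -> in_span s v.
Proof.
elim: s => //= w s IHs; rewrite inE => /orP[/eqP ->|/IHs sv].
  by exists 1, 0; rewrite scale1r addr0; split=> //; exact: in_span0.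
by exists 0, v; rewrite scale0r add0r.
Qed.

Lemma in_span_min V (s : seq V) (S : V -> Prop) :
  S 0 -> (forall a x y, S x -> S y -> S (a *: x + y)) ->
  (forall v, v \in s -> S v) -> forall x, in_span s x -> S x.
Proof.
move=> S0 SL; elim: s => [|v s IHs] sS x /=; first by move=> ->.
move=> [a [y [sy ->]]]; apply: SL; first exact/sS/mem_head.
by apply: IHs sy => w ws; apply: sS; rewrite inE ws orbT.
Qed.

Lemma fin_gen_surj V W (f : {linear V -> W}) :
  (forall y, exists x, f x = y) -> fin_gen V -> fin_gen W.
Proof.
move=> fs /fin_genP [s sP]; apply/fin_genP; exists (map f s) => y.
have [x <-] := fs y; apply: (in_span_min (S := fun x => in_span (map f s) (f x))) (sP x).
- by rewrite linear0; exact: in_span0.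
- by move=> a u v; rewrite linearP; exact: in_spanP_lin.
- by move=> v vs; exact/mem_in_span/map_f.
Qed.

(** Induction on the generators of the ambient module: the coefficients at the
    first generator form an ideal. *)
Lemma noetherian_sub V (S : V -> Prop) (s : seq V) : noetherian k ->
  S 0 -> (forall a x y, S x -> S y -> S (a *: x + y)) ->
  (forall x, S x -> in_span s x) ->
  exists s', (forall v, v \in s' -> S v) /\ forall x, S x -> in_span s' x.
Proof.
move=> nk; elim: s S => [|v s IHs] S S0 SL Ss; first by exists [::].
have [|||s1 [s1S Ss1]] := IHs (fun x => S x /\ in_span s x).
- by split=> //; exact: in_span0.
- by move=> a x y [Sx sx] [Sy sy]; split; [exact: SL | exact: in_spanP_lin].
- by move=> x [].
pose I a := exists y, in_span s y /\ S (a *: v + y).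
have [|cs csP] := nk I.
  split.
  - by exists 0; rewrite scale0r addr0; split=> //; exact: in_span0.
  - move=> a b [x [sx Sx]] [y [sy Sy]]; exists (x + y); split; first exact: in_spanD.
    have := SL 1 _ _ Sx Sy; rewrite scale1r scalerDl !addrA; congr S.
    by congr (_ + _); rewrite addrAC.
  move=> c a [x [sx Sx]]; exists (c *: x); split; first exact: in_spanZ.
  by have := SL c _ _ Sx S0; rewrite addr0 scalerDr scalerA.
have csI c : c \in cs -> I c.
  move=> cc; apply/csP; have ci : (index c cs < size cs)%N by rewrite index_mem.
  exists (fun i => (i == Ordinal ci)%:R).
  rewrite (bigD1 (Ordinal ci)) //= eqxx mul1r nth_index // big1 ?addr0 // => i.
  by move=> /negPf ->; rewrite mul0r.
pose w c := if pselect (I c) is left Ic then sval (cid Ic) else 0.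
have wP c : c \in cs -> in_span s (w c) /\ S (c *: v + w c).
  by move=> /csI Ic; rewrite /w; case: pselect => // Ic'; case: cid.
exists ([seq c *: v + w c | c <- cs] ++ s1); split.
  move=> x; rewrite mem_cat => /orP[/mapP[c /wP [_ Sc] -> //]|/s1S []//].
have sub1 x : in_span s1 x -> in_span ([seq c *: v + w c | c <- cs] ++ s1) x.
  apply: in_span_min => [|a u u'|u us]; [exact: in_span0|exact: in_spanP_lin|].
  by apply: mem_in_span; rewrite mem_cat us orbT.
move=> x Sx; have /= [a [y [sy xE]]] := Ss x Sx.
have /csP [c aE] : I a by exists y; rewrite -xE.
pose z := \sum_(i < size cs) c i *: (cs`_i *: v + w cs`_i).
have wi (i : 'I_(size cs)) := wP cs`_i (mem_nth 0 (ltn_ord i)).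
have Sz : S z.
  rewrite /z; elim/big_ind: _ => [//|u u' Su Su'|i _].
    by rewrite -[u]scale1r; exact: SL.
  by rewrite -[_ *: _]addr0; apply: SL => //; case: (wi i).
have xz : x - z = y - \sum_(i < size cs) c i *: w cs`_i.
  have -> : z = (\sum_i c i * cs`_i) *: v + \sum_(i < size cs) c i *: w cs`_i.
    by rewrite scaler_suml -big_split; apply: eq_bigr => i _; rewrite scalerDr scalerA.
  by rewrite xE aE opprD addrACA subrr add0r.
rewrite -[x](subrK z); apply: in_spanD.
  apply/sub1/Ss1; split; first by rewrite addrC -scaleN1r; exact: SL.
  rewrite xz addrC -scaleN1r; apply: in_spanP_lin => //.
  by apply: in_span_sum => i _; apply: in_spanZ; case: (wi i).
apply: in_span_sum => i _; apply/in_spanZ/mem_in_span.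
by rewrite mem_cat; apply/orP; left; apply/mapP; exists cs`_i; rewrite ?mem_nth.
Qed.

Lemma fin_gen_ker V W (f : {linear V -> W}) : noetherian k ->
  fin_gen V -> fin_gen (kermod f).
Proof.
move=> nk /fin_genP [s sP].
have [||s' [s'K Ks']] := @noetherian_sub V (fun x => f x = 0) s nk _ _ (fun x _ => sP x).
- exact: linear0.
- by move=> a x y fx fy; rewrite linearP fx fy scaler0 addr0.
pose up x : kermod f := insubd (0 : kermod f) x.
have upK x : f x = 0 -> val (up x) = x.
  by move=> fx; rewrite val_insubd; case: ifP => // /negP []; apply/eqP.
apply/fin_genP; exists (map up s') => x.
have fx := kermodP x; have := Ks' _ fx.
have : forall y, in_span s' y -> in_span (map up s') (up y).
  move=> y sy; suff [] : f y = 0 /\ in_span (map up s') (up y) by [].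
  move: y sy; apply: in_span_min.
  - split; first exact: linear0.
    rewrite (_ : up 0 = 0); first exact: in_span0.
    by apply: val_inj; rewrite upK ?linear0.
  - move=> a y z [fy sy] [fz sz]; have fyz : f (a *: y + z) = 0.
      by rewrite linearP fy fz scaler0 addr0.
    split=> //; rewrite (_ : up _ = a *: up y + up z); first exact: in_spanP_lin.
    by apply: val_inj; rewrite /= !upK.
  - move=> v vs; split; first exact: s'K.
    by apply: mem_in_span; exact: map_f.
by move=> /[apply]; congr in_span; apply: val_inj; rewrite upK.
Qed.

Lemma fin_gen_freeg (X : choiceType) (s : seq X) :
  (forall x, x \in s) -> fin_gen {freeg X / k}.
Proof.
move=> all_s; apply/fin_genP; exists (map (@gen k X) s) => u.
rewrite (freegE u); apply: in_span_sum => x _; apply/in_spanZ/mem_in_span.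
exact: map_f.
Qed.

End FinGen.

(** * Resolutions of finite type *)

(** The fibers are lists without repetition, hence of bounded length. *)
Lemma enum_hom n m : exists s : seq (hom n m), forall a, a \in s.
Proof.
pose code (a : hom n m) : {ffun 'I_m.+1 -> n.+1.-bseq 'I_n.+1} :=
  [ffun j => insub_bseq n.+1 (hord a j)].
have code_inj : injective code.
  move=> a b ab; apply: hord_eq => j.
  have := congr1 (fun f : {ffun 'I_m.+1 -> n.+1.-bseq 'I_n.+1} => bseqval (f j)) ab.
  have sz (c : hom n m) : (size (hord c j) <= n.+1)%N.
    by rewrite -(card_uniqP (hord_uniq c j)) (leq_trans (max_card _)) // card_ord.
  have bs (c : hom n m) : insub_bseq n.+1 (hord c j) = hord c j :> seq _.
    by rewrite val_insubd sz.
  by rewrite /= !ffunE !bs.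
exists (pmap (fun x => if pselect (exists a, code a = x) is left h
                       then Some (sval (cid h)) else None) (enum predT)) => a.
rewrite mem_pmap; apply/mapP; exists (code a); first by rewrite mem_enum.
case: pselect => [h|[]]; last by exists a.
by congr Some; case: cid => b /= /code_inj.
Qed.

Section FiniteType.
Variable k : comNzRingType.
Implicit Type M : confun k.

Definition fg_functor M : Prop := exists (J : finType) (deg : J -> nat)
  (e : nattrans (free_functor k deg) M), pointwise_surj e.

Lemma fin_gen_free_functor (J : finType) (deg : J -> nat) n :
  fin_gen (free_functor k deg n).
Proof.
pose homs j := sval (cid (enum_hom n (deg j))).
apply: (@fin_gen_freeg _ _ (flatten [seq [seq fbas a | a <- homs j] | j <- enum J])).
case=> j a; apply/flatten_mapP; exists j; first by rewrite mem_enum.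
by apply/mapP; exists a => //; rewrite /homs; case: cid => /= s; apply.
Qed.

(** Over a noetherian ring this condition is inherited by suitable syzygies, so
    it yields a resolution by free functors on finitely many generators. *)
Definition fp_infty M : Prop :=
  (forall q, exists N, forall n, (N <= n)%N -> exact_at M n q)
  /\ forall n, fin_gen (M n).

Lemma fp_infty_cst : fp_infty (cst_fun k).
Proof.
split=> [q|n]; first by exists (4 * q + 2)%N => n Nn; apply: exact_at_cst; lia.
exists [:: 1] => x; exists (fun=> x); rewrite big_ord1 /=.
by rewrite /GRing.scale /= mulr1.
Qed.

(** Exactness in degree 0 says that an element of large arity is a sum of
    elements fixed by a contraction, and these come from smaller arity. *)
Lemma contraction_generated M n (S : forall n, M n -> Prop) : exact_at M n.+1 0 ->
  S n.+1 0 -> (forall x y, S n.+1 x -> S n.+1 y -> S n.+1 (x + y)) ->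
  (forall (a : hom n.+1 n) y, S n y -> S n.+1 (fmap M a y)) ->
  (forall y, S n y) -> forall x, S n.+1 x.
Proof.
move=> ex S0 SD Sa Sn x.
pose z (t : seq ('I_n.+2 * 'I_n.+2)) : M n.+1 := if t is [::] then x else 0.
have zch : @contraction_chain _ M n.+1 0 z.
  split; last by move=> [|e t] u //= _; rewrite linear0.
  split; first by split=> [[|? ?] *|[|? ?] *]; rewrite /= ?oppr0.
  move=> [|e t]; last by rewrite /= eqxx.
  move=> _; split=> //; exists (enum 'I_n.+2); split=> //.
    exact: enum_uniq.
  by move=> y; rewrite mem_enum.
have [|c [[altc cq] ct] cz] := ex z zch; first by move=> t; rewrite /bd big1.
have -> : x = bd c [::] by rewrite cz.
rewrite /bd; elim/big_ind: _ => // e _.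
have [->|/cq [[w [uw _ wt]] _]] := eqVneq (c [:: e]) 0; first exact: S0.
have e12 : e.1 != e.2 by apply: follows_neq uw _; apply: wt; rewrite inE.
have [a [b ab]] := contract_factor e12.
rewrite -(ct [:: e] e) ?mem_head // ab fmap_comp; exact/Sa/Sn.
Qed.

Lemma fp_infty_fg M : fp_infty M -> fg_functor M.
Proof.
move=> [exM fgM]; have [N Nex] := exM 0%N.
pose s n := sval (cid (proj1 (fin_genP _) (fgM n))).
have sP n x : in_span (s n) x by rewrite /s; case: cid.
pose J : finType := {m : 'I_N.+1 & 'I_(size (s m))}.
pose deg (j : J) : nat := tag j.
pose e := @free_ext_nat k J deg M (fun j => (s (tag j))`_(tagged j)).
exists J, deg, e.
pose S n (y : M n) := exists x, e n x = y.
have SL n a x y : S n x -> S n y -> S n (a *: x + y).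
  by move=> [x' <-] [y' <-]; exists (a *: x' + y'); rewrite linearP.
have S0 n : S n 0 by exists 0; rewrite linear0.
have SD n x y : S n x -> S n y -> S n (x + y).
  by move=> Sx Sy; rewrite -[x]scale1r; exact: SL.
have Sa n m (a : hom n m) y : S m y -> S n (fmap M a y).
  by move=> [x <-]; exists (fmap (free_functor k deg) a x); rewrite ncompP.
have small n : (n <= N)%N -> forall y, S n y.
  move=> nN y; apply: (in_span_min (S := @S n)) (sP n y) => [||v vs].
  - exact: S0.
  - exact: SL.
  pose i := Ordinal (nN : (n < N.+1)%N).
  have vi : (index v (s n) < size (s i))%N by rewrite index_mem.
  pose j : J := Tagged (fun m : 'I_N.+1 => 'I_(size (s m))) (Ordinal vi).
  exists (gen k (fbas (deg := deg) (j := j) (hid n))).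
  by apply: etrans (free_liftE _ _) _; rewrite /= fmap_id nth_index.
elim=> [|n IHn]; first exact: small.
have [nN|Nn] := leqP n.+1 N; first exact: small.
apply: (contraction_generated (S := S) (Nex _ (ltnW Nn)) (S0 _) (@SD _) _ IHn).
by move=> a y; exact: Sa.
Qed.

(** The complex of the cover is exact in arities above the degrees of its
    generators, so the kernel is exact in degree q where M is in degree q + 1. *)
Lemma fp_infty_syzygy M : noetherian k -> fp_infty M ->
  exists (J : finType) (deg : J -> nat) (e : nattrans (free_functor k deg) M),
    pointwise_surj e /\ fp_infty (ker_fun e).
Proof.
move=> nk gM; have [J [deg [e es]]] := fp_infty_fg gM.
exists J, deg, e; split=> //; split=> [q|n]; last first.
  by apply: fin_gen_ker => //; exact: fin_gen_free_functor.
have [N NM] := proj1 gM q.+1.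
exists (maxn N (\max_j (deg j)).+1) => n; rewrite geq_max => /andP[Nn dn].
apply: exact_at_ker => //; last exact: NM.
by apply: exact_at_free => j; apply: leq_trans dn; rewrite ltnS leq_bigmax.
Qed.

Record finite_cover M := FiniteCover {
  fcov_idx : finType;
  fcov_deg : fcov_idx -> nat;
  fcov :> nattrans (free_functor k fcov_deg) M;
  fcov_surj : pointwise_surj fcov;
  fcov_ker : fp_infty (ker_fun fcov) }.

Lemma choose_cover M : noetherian k -> fp_infty M -> finite_cover M.
Proof.
move=> nk /(fp_infty_syzygy nk) /cid [J /cid [deg /cid [e [es eK]]]].
exact: FiniteCover es eK.
Qed.

Theorem finite_resolution : noetherian k ->
  exists F : proj_resolution (cst_fun k), forall i, fg_functor (F i).
Proof.
move=> nk.
pose cov (S : {M | fp_infty M}) := choose_cover nk (svalP S).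
pose fix syz i : {M | fp_infty M} :=
  if i is j.+1 then exist _ (ker_fun (cov (syz j))) (fcov_ker (cov (syz j)))
  else exist _ (cst_fun k) fp_infty_cst.
pose d i := ntcomp (ker_incl (cov (syz i))) (cov (syz i.+1)).
have dE i n (x : free_functor k (@fcov_deg _ (cov (syz i.+1))) n) :
    d i n x = val (cov (syz i.+1) n x : kermod (cov (syz i) n)) by [].
have lift_ker i n (x : free_functor k (@fcov_deg _ (cov (syz i))) n) :
    cov (syz i) n x = 0 <-> exists y, x = d i n y.
  split=> [x0|[y ->]]; last exact: kermodP.
  have xk : kerpred (cov (syz i) n) x by apply/eqP.
  have [y yx] := @fcov_surj _ (cov (syz i.+1)) n
    (exist (fun y => kerpred (cov (syz i) n) y) x xk : kermod (cov (syz i) n)).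
  by exists y; rewrite dE yx.
unshelve eexists.
  exists (fun i => free_functor k (@fcov_deg _ (cov (syz i)))) d (cov (syz 0%N)).
  - by move=> i; exact: free_projective.
  - exact: fcov_surj.
  - by move=> n x; exact: (lift_ker 0%N).
  - move=> i n x; rewrite -(lift_ker i.+1); split=> [x0|x0]; last by rewrite dE x0.
    by apply: val_inj; rewrite -dE.
move=> i; exists (fcov_idx (cov (syz i))), (@fcov_deg _ (cov (syz i))).
by exists (@NatTrans _ _ _ (fun n => idfun) (fun _ _ _ _ => erefl)) => n y; exists y.
Qed.

End FiniteType.

(** * Comparison of projective resolutions *)

Section Corestriction.
Variables (k : comNzRingType) (U V W : lmodType k).
Variables (f : {linear V -> W}) (g : {linear U -> V}).
Hypothesis fg : forall x, f (g x) = 0.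

Fact corestrict_in x : kerpred f (g x).
Proof. exact/eqP/fg. Qed.
Definition corestrict0 x : kermod f :=
  exist (fun y => kerpred f y) (g x) (corestrict_in x).
Fact corestrict_linear : linear corestrict0.
Proof. by move=> a x y; apply: val_inj; rewrite /= linearP. Qed.
HB.instance Definition _ :=
  GRing.isLinear.Build k U (kermod f) *:%R corestrict0 corestrict_linear.
Definition corestrict : {linear U -> kermod f} := corestrict0.

End Corestriction.

Section Comparison.
Variable k : comNzRingType.
Implicit Types X Y Z M : confun k.

Section NatTransOps.
Variables X Y Z : confun k.

Definition nt_id : nattrans X X :=
  @NatTrans _ _ _ (fun n => idfun) (fun _ _ _ _ => erefl).

Fact nt_sub_nat (u v : nattrans X Y) n m (a : hom n m) (x : X m) :
  (u n \- v n) (fmap X a x) = fmap Y a ((u m \- v m) x).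
Proof. by rewrite /= !ncompP linearB. Qed.
Definition nt_sub (u v : nattrans X Y) : nattrans X Y :=
  @NatTrans _ X Y (fun n => u n \- v n) (nt_sub_nat u v).

Variables (d : nattrans Y Z) (g : nattrans X Y).
Hypothesis dg : forall n x, d n (g n x) = 0.

Fact nt_corestrict_nat n m (a : hom n m) (x : X m) :
  corestrict (@dg n) (fmap X a x) = fmap (ker_fun d) a (corestrict (@dg m) x).
Proof. by apply: val_inj; rewrite /= ncompP. Qed.
Definition nt_corestrict : nattrans X (ker_fun d) :=
  @NatTrans _ X (ker_fun d) (fun n => corestrict (@dg n)) nt_corestrict_nat.

End NatTransOps.

(** Projectivity is about objectwise surjections, hence the corestriction of d
    to the kernel of d'. *)
Lemma lift_exact (P : confun k) X Y Z (d : nattrans X Y) (d' : nattrans Y Z)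
    (f : nattrans P Y) : projective P ->
  (forall n y, d' n y = 0 -> exists x, y = d n x) ->
  (forall n x, d' n (d n x) = 0) -> (forall n x, d' n (f n x) = 0) ->
  exists h : nattrans P X, forall n x, d n (h n x) = f n x.
Proof.
move=> projP ex dd fd.
have [|h hP] := projP _ _ (nt_corestrict dd) (nt_corestrict fd).
  move=> n y; have [x yx] := ex n (val (y : kermod (d' n))) (kermodP y).
  by exists x; apply: val_inj; rewrite /= yx.
by exists h => n x; exact: (congr1 val (hP n x : _ = _ :> kermod (d' n))).
Qed.

Section Cycles.
Variables (M : confun k) (Q : proj_resolution M).

Definition cycle i n : Q i n -> Prop :=
  match i return Q i n -> Prop with
  | 0%N => fun x => res_aug Q n x = 0
  | j.+1 => fun x => res_d Q j n x = 0
  end.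

Lemma cycle_d i n x : cycle (res_d Q i n x).
Proof. by case: i x => [|i] x /=; [apply/res_exact0|apply/res_exact]; exists x. Qed.

Lemma lift_cycles (P : confun k) i (f : nattrans P (Q i)) : projective P ->
  (forall n x, cycle (f n x)) ->
  exists h : nattrans P (Q i.+1), forall n x, res_d Q i n (h n x) = f n x.
Proof.
case: i f => [|i] f projP fc.
- apply: (lift_exact (d' := res_aug Q)) => // n x; first by move/res_exact0.
  exact: (@cycle_d 0).
- apply: (lift_exact (d' := res_d Q i)) => // n x; first by move/res_exact.
  exact: (@cycle_d i.+1).
Qed.

End Cycles.

Section ChainMaps.
Variable M : confun k.

Lemma comparison (P Q : proj_resolution M) :
  exists f : forall i, nattrans (P i) (Q i),
    (forall n x, res_aug Q n (f 0%N n x) = res_aug P n x) /\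
    (forall i n x, res_d Q i n (f i.+1 n x) = f i n (res_d P i n x)).
Proof.
(* Preserving cycles is all that the extension by one degree needs. *)
pose good i (f : nattrans (P i) (Q i)) :=
  forall n x, cycle x -> cycle (f n x).
have [f0 f0P] := @res_proj _ _ P 0 _ _ _ (res_aug P) (@res_aug_surj _ _ Q).
have g0 : good 0%N f0 by move=> n x; rewrite /= f0P.
have step i (f : {f | good i f}) : {g : {g | good i.+1 g} |
    forall n x, res_d Q i n (sval g n x) = sval f n (res_d P i n x)}.
  case: f => f gf /=.
  have [|g gP] := cid (lift_cycles (f := ntcomp f (res_d P i)) (@res_proj _ _ P i.+1) _).
    by move=> n x; apply: gf; exact: cycle_d.
  have gg : good i.+1 g by move=> n x /= dx; rewrite gP /= dx linear0.
  by exists (exist _ g gg).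
pose fix f i : {f | good i f} :=
  if i is j.+1 then sval (step j (f j)) else exist _ f0 g0.
exists (fun i => sval (f i)); split=> [n x|i n x]; first exact: f0P.
exact: (svalP (step i (f i))).
Qed.

Lemma homotopic_id (P : proj_resolution M) (f : forall i, nattrans (P i) (P i)) :
  (forall n x, res_aug P n (f 0%N n x) = res_aug P n x) ->
  (forall i n x, res_d P i n (f i.+1 n x) = f i n (res_d P i n x)) ->
  exists h : forall i, nattrans (P i) (P i.+1),
    (forall n x, f 0%N n x = x + res_d P 0%N n (h 0%N n x)) /\
    (forall i n x, f i.+1 n x =
       x + res_d P i.+1 n (h i.+1 n x) + h i n (res_d P i n x)).
Proof.
move=> faug fd.
pose good i (h : nattrans (P i) (P i.+1)) :=
  forall n x, cycle x -> res_d P i n (h n x) = f i n x - x.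
have [|h0 h0P] := lift_cycles (f := nt_sub (f 0%N) (nt_id _)) (@res_proj _ _ P 0).
  by move=> n x; rewrite /= linearB /= faug subrr.
have g0 : good 0%N h0 by move=> n x _; rewrite h0P.
have step i (h : {h | good i h}) : {g : {g | good i.+1 g} | forall n x,
    res_d P i.+1 n (sval g n x) = f i.+1 n x - x - sval h n (res_d P i n x)}.
  case: h => h gh /=.
  have [|g gP] := cid (lift_cycles
      (f := nt_sub (nt_sub (f i.+1) (nt_id _)) (ntcomp h (res_d P i)))
      (@res_proj _ _ P i.+1) _).
    move=> n x /=; rewrite !linearB /= fd gh ?subrr //; exact: cycle_d.
  have gg : good i.+1 g by move=> n x /= dx; rewrite gP /= dx linear0 subr0.
  by exists (exist _ g gg).
pose fix h i : {h | good i h} :=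
  if i is j.+1 then sval (step j (h j)) else exist _ h0 g0.
exists (fun i => sval (h i)); split=> [n x|i n x].
  by rewrite h0P /= addrC subrK.
have -> := svalP (step i (h i)) n x.
by rewrite -addrA subrK addrC subrK.
Qed.

End ChainMaps.
End Comparison.

(** * Tensor products over Delta S *)

HB.instance Definition _ (k : comNzRingType) (I : eqType) (F : I -> lmodType k) i :=
  GRing.isLinear.Build k (F i) (dsum F) *:%R (@din k I F i)
    (fun c x y => din_is_linear c x y).
Definition dinl (k : comNzRingType) (I : eqType) (F : I -> lmodType k) i :
  {linear F i -> dsum F} := @din k I F i.

Section Generation.
Variable k : comNzRingType.
Implicit Types V W : lmodType k.

Definition submodule V (S : V -> Prop) :=
  S 0 /\ forall a x y, S x -> S y -> S (a *: x + y).

Lemma submodule_sum V (S : V -> Prop) (I : Type) (r : seq I) (F : I -> V) :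
  submodule S -> (forall i, S (F i)) -> S (\sum_(i <- r) F i).
Proof.
move=> [S0 SL] SF; elim/big_ind: _ => // x y Sx Sy.
by rewrite -[x]scale1r; exact: SL.
Qed.

Lemma submodule_preim V W (f : {linear V -> W}) (S : W -> Prop) :
  submodule S -> submodule (fun x => S (f x)).
Proof.
by move=> [S0 SL]; split=> [|a x y]; rewrite ?linear0 // linearP; exact: SL.
Qed.

Lemma submodule_eq V W (f g : {linear V -> W}) : submodule (fun x => f x = g x).
Proof. by split=> [|a x y fx fy]; rewrite ?linear0 // !linearP fx fy. Qed.

Lemma submodule_in_span V (s : seq V) : submodule (in_span s).
Proof. by split=> [|a x y]; [exact: in_span0 | exact: in_spanP_lin]. Qed.

Lemma freeg_ind (X : choiceType) (S : {freeg X / k} -> Prop) :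
  submodule S -> (forall x, S (gen k x)) -> forall u, S u.
Proof.
move=> subS Sgen u; rewrite (freegE u); apply: submodule_sum => // x.
by rewrite -[_ *: _]addr0; have [S0 SL] := subS; exact: SL.
Qed.

Lemma qfree_ind (X : choiceType) (R : {freeg X / k} -> Prop) (S : qmod R -> Prop) :
  submodule S -> (forall x, S (qproj R (gen k x))) -> forall u, S u.
Proof.
move=> subS Sgen; elim/qmod_ind; apply: freeg_ind => //.
exact: submodule_preim.
Qed.

Lemma dsum_ind (I : eqType) (F : I -> lmodType k) (S : dsum F -> Prop) :
  submodule S -> (forall i (x : F i), S (din x)) -> forall u, S u.
Proof.
move=> subS Sdin u; have /asboolP [s us] := valP u.
have -> : u = \sum_(i <- undup s) din (val u i).
  apply: val_inj; apply: functional_extensionality_dep => j.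
  have -> : val (\sum_(i <- undup s) din (val u i)) j
      = \sum_(i <- undup s) din_fun (val u i) j.
    by elim/big_rec2: _ => // i x y _ <-.
  have [js|js] := boolP (j \in undup s); last first.
    rewrite us; last by rewrite -mem_undup.
    rewrite big_seq big1 // => i iS; rewrite /din_fun.
    by case: eqP => // e; rewrite -e iS in js.
  rewrite (bigD1_seq j) ?undup_uniq //= big1 ?addr0 => [|i /eqP ij].
    by rewrite /din_fun; case: eqP => // e; rewrite eq_axiomK.
  by rewrite /din_fun; case: eqP.
exact: submodule_sum.
Qed.

End Generation.

Section TensorDS.
Variables (k : comNzRingType) (N : covfun k).
Implicit Type M : confun k.

Definition tclass M n (y : M n) (x : N n) : tensDS N M :=
  qproj (@tensDS_rel k N M) (sum_pure y x).

Lemma tensDS_ind M (S : tensDS N M -> Prop) : submodule S ->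
  (forall n (y : M n) (x : N n), S (tclass y x)) -> forall u, S u.
Proof.
move=> subS Sc; elim/qmod_ind; apply: dsum_ind => [|n].
  exact: submodule_preim.
apply: qfree_ind; last by case=> y x; exact: Sc.
exact: (submodule_preim (@dinl k _ (fun n => tens (M n) (N n)) n)
  (submodule_preim (qproj _) subS)).
Qed.

Lemma tensDS_ext M (U : lmodType k) (f g : {linear tensDS N M -> U}) :
  (forall n (y : M n) (x : N n), f (tclass y x) = g (tclass y x)) -> f =1 g.
Proof. by move=> fg; apply: tensDS_ind fg; exact: submodule_eq. Qed.

Definition tclassl M n (x : N n) (y : M n) : tensDS N M := tclass y x.

Fact tclassl_linear M n (x : N n) : linear (@tclassl M n x).
Proof.
move=> c y y'; rewrite /tclassl /tclass /sum_pure pure_linl.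
exact: (linearP (qproj _ \o @dinl k _ (fun n => tens (M n) (N n)) n)).
Qed.
HB.instance Definition _ M n (x : N n) :=
  GRing.isLinear.Build k (M n) (tensDS N M) *:%R (@tclassl M n x)
    (@tclassl_linear M n x).

Fact tclass_linear M n (y : M n) : linear (@tclass M n y).
Proof.
move=> c x x'; rewrite /tclass /sum_pure pure_linr.
exact: (linearP (qproj _ \o @dinl k _ (fun n => tens (M n) (N n)) n)).
Qed.
HB.instance Definition _ M n (y : M n) :=
  GRing.isLinear.Build k (N n) (tensDS N M) *:%R (@tclass M n y)
    (@tclass_linear M n y).

Lemma tclass_act M n m (a : hom n m) (y : M m) (x : N n) :
  tclass y (cmap N a x) = tclass (fmap M a y) x.
Proof.
by have := qproj_eq0 (TensDSRel a y x); rewrite linearB => /eqP; rewrite subr_eq0 => /eqP.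
Qed.

Lemma tensDS_mapE M M' (e : nattrans M M') n (y : M n) (x : N n) :
  tensDS_map N e (tclass y x) = tclass (e n y) x.
Proof.
rewrite /tensDS_map /tclass qliftE /tensDS_map0 /= /sum_pure dmap_in.
by rewrite tens_mapE.
Qed.

(** If g is a generator of M, then the tensor of the pullback of g along a with
    x is the tensor of g with the image of x under a. *)
Lemma fin_gen_tensDS M : fg_functor M -> (forall n, fin_gen (N n)) ->
  fin_gen (tensDS N M).
Proof.
move=> [J [deg [e es]]] Nfg; apply/fin_genP.
pose s n := sval (cid (proj1 (fin_genP _) (Nfg n))).
have sP n x : in_span (s n) x by rewrite /s; case: cid.
pose b j : M (deg j) := e _ (gen k (fbas (hid (deg j)))).
pose G : seq (tensDS N M) :=
  flatten [seq [seq tclass (b j) x | x <- s (deg j)] | j <- enum J].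
have subG n y : submodule (fun x : N n => in_span G (@tclass M n y x)).
  exact/submodule_preim/submodule_in_span.
have GP j x : in_span G (tclass (b j) x).
  apply: (in_span_min (S := fun x => in_span G (tclass (b j) x))) (sP _ x) => [||y ys].
  - by case: (subG _ (b j)).
  - by case: (subG _ (b j)).
  - apply/mem_in_span/flatten_mapP; exists j; first by rewrite mem_enum.
    exact: map_f.
exists G; apply: tensDS_ind => [|n y x]; first exact: submodule_in_span.
have [z <-] := es n y; move: z; apply: freeg_ind.
  exact: (submodule_preim (tclassl x \o e n) (submodule_in_span G)).
case=> j a; have -> : gen k (existT _ j a) =
    fmap (free_functor k deg) a (gen k (fbas (hid (deg j)))).
  by rewrite /= free_mapE /fbas_act hcomp1l.
by rewrite ncompP -tclass_act.
Qed.

End TensorDS.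

(** * Finite generation of symmetric homology *)

Section Tpow.
Variables (k : comNzRingType) (A : algType k).

Lemma fin_gen_tpow n : fin_gen A -> fin_gen (tpow A n).
Proof.
move=> /fin_genP [s sP]; apply/fin_genP.
pose fam (c : {ffun 'I_n.+1 -> 'I_(size s)}) : {ffun 'I_n.+1 -> A} :=
  [ffun i => s`_(c i)].
exists [seq ptens (fam c) | c <- enum predT].
set G := map _ _; apply: qfree_ind; first exact: submodule_in_span.
move=> a; rewrite -/(ptens a).
(* The entries are expanded in the generators of A one position at a time, the
   positions from m on being expanded already. *)
suff H m (a' : {ffun 'I_n.+1 -> A}) :
    (forall i : 'I_n.+1, (m <= i)%N -> a' i \in s) -> in_span G (ptens a').
  by apply: (H n.+1) => i; rewrite leqNgt ltn_ord.
elim: m a' => [|m IHm] b bs.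
  have ci i : (index (b i) s < size s)%N by rewrite index_mem bs.
  rewrite (_ : b = fam [ffun i => Ordinal (ci i)]).
    by apply/mem_in_span/map_f; rewrite mem_enum.
  by apply/ffunP => i; rewrite !ffunE nth_index ?bs.
have [mn|nm] := ltnP m n.+1; last first.
  by apply: IHm => i mi; have := leq_trans nm mi; rewrite leqNgt ltn_ord.
pose i := Ordinal mn.
have lin : linear (fun x => ptens (upd b i x)) by move=> c x y; exact: ptens_linear.
pose f : {linear A -> tpow A n} := HB.pack (fun x => ptens (upd b i x))
  (GRing.isLinear.Build k _ _ _ _ lin).
have <- : f (b i) = ptens b.
  by congr ptens; apply/ffunP => j; rewrite ffunE; case: eqP => [->|].
have [S0 SL] := submodule_preim f (submodule_in_span G).
apply: (in_span_min S0 SL) (sP (b i)) => v vs; apply: IHm => j mj; rewrite ffunE.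
case: eqP => // /eqP ji; apply: bs; rewrite ltn_neqAle mj andbT.
by apply: contraNneq ji => jm; apply/eqP/val_inj.
Qed.

End Tpow.

Section TorFinGen.
Variables (k : comNzRingType) (N : covfun k) (M : confun k).
Variables (P F : proj_resolution M).

(** F and P are chain homotopy equivalent, so every cycle of P is homologous to
    the image of a cycle of F. *)
Theorem fin_gen_Tor i : noetherian k -> (forall n, fin_gen (N n)) ->
  fg_functor (F i) -> fin_gen (Tor N P i).
Proof.
move=> nk Nfg Ffg.
have [f [faug fd]] := comparison F P; have [g [gaug gd]] := comparison P F.
have [||h [h0 hS]] := @homotopic_id _ _ P (fun i => ntcomp (f i) (g i)).
- by move=> n x; rewrite /= faug gaug.
- by move=> j n x; rewrite /= fd gd.
have chain_map (Q R : proj_resolution M) (u : forall i, nattrans (Q i) (R i)) :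
    (forall i n x, res_d R i n (u i.+1 n x) = u i n (res_d Q i n x)) ->
    forall z : kermod (tor_d N Q i), tor_d N R i (tensDS_map N (u i) (val z)) = 0.
  move=> ud z; have := kermodP z; case: i z {Ffg} => [|j] z zc //.
  change (tensDS_map N (res_d Q j) (val z) = 0) in zc.
  change (tensDS_map N (res_d R j) (tensDS_map N (u j.+1) (val z)) = 0).
  apply: (@etrans _ _ (tensDS_map N (u j) (tensDS_map N (res_d Q j) (val z))));
    last first.
    by rewrite zc linear0.
  apply: (@tensDS_ext _ _ _ _ (tensDS_map N (res_d R j) \o tensDS_map N (u j.+1))
    (tensDS_map N (u j) \o tensDS_map N (res_d Q j))) => n y x.
  change (tensDS_map N (res_d R j) (tensDS_map N (u j.+1) (tclass y x))
    = tensDS_map N (u j) (tensDS_map N (res_d Q j) (tclass y x))).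
  by rewrite !tensDS_mapE ud.
pose fK := corestrict (f := tor_d N P i)
  (g := tensDS_map N (f i) \o (val : kermod (tor_d N F i) -> _)) (chain_map F P f fd).
pose gK := corestrict (f := tor_d N F i)
  (g := tensDS_map N (g i) \o (val : kermod (tor_d N P i) -> _)) (chain_map P F g gd).
apply: (@fin_gen_surj _ (kermod (tor_d N F i)) _ (qproj _ \o fK)); last first.
  by apply: fin_gen_ker => //; exact: fin_gen_tensDS.
elim/qmod_ind => z; exists (gK z); apply/qproj0_eq/mem_span.
exists (tensDS_map N (h i) (val z)).
change (tensDS_map N (f i) (tensDS_map N (g i) (val z)) - val z
  = tensDS_map N (res_d P i) (tensDS_map N (h i) (val z))).
have zc := kermodP z; apply/eqP; rewrite subr_eq addrC; apply/eqP.
case: i h h0 hS z zc {Ffg fK gK chain_map} => [|j] h h0 hS z zc.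
  apply: (@tensDS_ext _ _ _ _ (tensDS_map N (f 0%N) \o tensDS_map N (g 0%N))
    (idfun \+ (tensDS_map N (res_d P 0%N) \o tensDS_map N (h 0%N)))) => n y x.
  change (tensDS_map N (f 0%N) (tensDS_map N (g 0%N) (tclass y x))
    = tclass y x + tensDS_map N (res_d P 0%N) (tensDS_map N (h 0%N) (tclass y x))).
  rewrite !tensDS_mapE -[tclass (f _ _ _) x]/(tclassl x _).
  by rewrite [f _ _ _]h0 linearD.
change (tensDS_map N (res_d P j) (val z) = 0) in zc.
have <- : val z + tensDS_map N (res_d P j.+1) (tensDS_map N (h j.+1) (val z))
    + tensDS_map N (h j) (tensDS_map N (res_d P j) (val z)) = 
    val z + tensDS_map N (res_d P j.+1) (tensDS_map N (h j.+1) (val z)).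
  by rewrite zc linear0 addr0.
apply: (@tensDS_ext _ _ _ _ (tensDS_map N (f j.+1) \o tensDS_map N (g j.+1))
    (idfun \+ (tensDS_map N (res_d P j.+1) \o tensDS_map N (h j.+1))
     \+ (tensDS_map N (h j) \o tensDS_map N (res_d P j)))) => n y x.
change (tensDS_map N (f j.+1) (tensDS_map N (g j.+1) (tclass y x))
  = tclass y x + tensDS_map N (res_d P j.+1) (tensDS_map N (h j.+1) (tclass y x))
    + tensDS_map N (h j) (tensDS_map N (res_d P j) (tclass y x))).
rewrite !tensDS_mapE -[tclass (f _ _ _) x]/(tclassl x _).
by rewrite [f _ _ _]hS !linearD.
Qed.

End TorFinGen.

Theorem corollary97 (k : comNzRingType) (A : algType k)
    (eps : {lrmorphism A -> k^o}) :
  noetherian k ->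
  free_countable (kermod eps) ->
  fin_gen A ->
  forall (P : proj_resolution (cst_fun k)) (i : nat), fin_gen (HS A P i).
Proof.
move=> nk _ Afg P i; have [F Ffg] := finite_resolution nk.
by apply: (@fin_gen_Tor _ _ _ P F) => // n; exact: fin_gen_tpow.
Qed.
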